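(* Let $\omega_1,\omega_2,\omega_3,\omega_4$ be the quantities, depending on the integer $n>2$ and on the real number $\alpha$, defined in the context. For fixed $\alpha$: 1. If $\alpha<0$, then $\omega_1$ increases as $n$ increases, and $\lim_{n\to\infty}\omega_1=0$. 2. If $\alpha>1$, then $\omega_2$ decreases as $n$ increases, and $\lim_{n\to\infty}\omega_2=0$. 3. If $\frac12<\alpha<1$, then $\omega_3$ increases as $n$ increases in the interval $0<n<\frac1{1-\alpha}$. 4. If $0<\alpha<\frac12$, then $\omega_4$ decreases as $n$ increases in the interval $0<n<\frac1\alpha$. Here $n$ ranges over integers $n>2$ (in parts 3 and 4, over those that also lie in the indicated interval).
   Context: Let $n>2$ be an integer, $\alpha\neq0,1$ real, and $r=\frac1\alpha$. Define for $0< x<\frac1{n-1}$, $x\neq\frac1n$, $$f(x)=\frac{g(x)-\frac1n}{p(x)-\frac1n},\qquad g(x)=\sqrt[n]{x^{n-1}(1-(n-1)x)},\qquad p(x)=\left(\frac{(n-1)x^{\frac1r}+(1-(n-1)x)^{\frac1r}}{n}\right)^r.$$ Then: - for $\alpha<0$, $\omega_1=\frac{\nu_1}{\nu_1-1}$, where $\nu_1$ is the minimum of $f$ in $\left(\frac1n,\frac1{n-1}\right)$; - for $\alpha>1$, $\omega_2=\frac{\nu_2}{\nu_2-1}$, where $\nu_2$ is the maximum of $f$ in $\left(0,\frac1n\right)$; - for $\frac12<\alpha<1$ and $n<\frac1{1-\alpha}$, $\omega_3=\frac{\nu_3}{\nu_3-1}$, where $\nu_3$ is the minimum of $f$ in $\left(0,\frac1n\right)$;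 - for $0<\alpha<\frac12$ and $n<\frac1\alpha$, $\omega_4=\frac{\nu_4}{\nu_4-1}$, where $\nu_4$ is the maximum of $f$ in $\left(\frac1n,\frac1{n-1}\right)$. These minima and maxima exist in the indicated cases. Moreover, with $A_n$, $G_n$, $P_\alpha$ the arithmetic, geometric and order-$\alpha$ power means of non-negative reals $x_1,\dots,x_n$ (where $P_\alpha=0$ if $\alpha<0$ and some $x_i=0$), $\omega_1$ and $\omega_3$ are the maximum, and $\omega_2$ and $\omega_4$ the minimum, of $\frac{A_n-G_n}{P_\alpha-G_n}$ over all $(x_1,\dots,x_n)$ with $P_\alpha\ne G_n$, in the respective cases. *)

(* Defs.v *)
From Stdlib Require Import Reals ClassicalEpsilon.
Open Scope R_scope.

(* [Rpower] is the usual real power only for a positive base; for [alpha <> 0]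
   and 0 < x < 1/(n-1), the only values used below, every base is positive. *)

Definition g (n : nat) (x : R) : R :=
  Rpower (x ^ (n - 1) * (1 - (INR n - 1) * x)) (1 / INR n).

Definition p (n : nat) (alpha x : R) : R :=
  let r := 1 / alpha in
  Rpower (((INR n - 1) * Rpower x (1 / r)
           + Rpower (1 - (INR n - 1) * x) (1 / r)) / INR n) r.

Definition f (n : nat) (alpha x : R) : R :=
  (g n x - 1 / INR n) / (p n alpha x - 1 / INR n).

Definition is_min_on (h : R -> R) (a b m : R) : Prop :=
  (exists x, a < x < b /\ h x = m) /\ (forall x, a < x < b -> m <= h x).

Definition is_max_on (h : R -> R) (a b m : R) : Prop :=
  (exists x, a < x < b /\ h x = m) /\ (forall x, a < x < b -> h x <= m).

(* The attained extremum of [h] on the open interval (a, b), which is unique if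
   it exists; an unspecified real if the extremum is not attained. *)
Definition min_on (h : R -> R) (a b : R) : R :=
  epsilon (inhabits 0) (is_min_on h a b).

Definition max_on (h : R -> R) (a b : R) : R :=
  epsilon (inhabits 0) (is_max_on h a b).

Definition nu1 (n : nat) (alpha : R) : R :=
  min_on (f n alpha) (1 / INR n) (1 / (INR n - 1)).
Definition nu2 (n : nat) (alpha : R) : R :=
  max_on (f n alpha) 0 (1 / INR n).
Definition nu3 (n : nat) (alpha : R) : R :=
  min_on (f n alpha) 0 (1 / INR n).
Definition nu4 (n : nat) (alpha : R) : R :=
  max_on (f n alpha) (1 / INR n) (1 / (INR n - 1)).

Definition omega1 (n : nat) (alpha : R) : R := nu1 n alpha / (nu1 n alpha - 1).
Definition omega2 (n : nat) (alpha : R) : R := nu2 n alpha / (nu2 n alpha - 1).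
Definition omega3 (n : nat) (alpha : R) : R := nu3 n alpha / (nu3 n alpha - 1).
Definition omega4 (n : nat) (alpha : R) : R := nu4 n alpha / (nu4 n alpha - 1).

(* Main.v *)
(** Scaling the largest of the two values to [1], the tuple behind [f n alpha x] takes the
    values [1] and [exp t], [t < 0], with weights [1 - w] and [w], where [w = 1/n] if
    [x > 1/n] and [w = 1 - 1/n] if [x < 1/n]; then [f] is the ratio [A / B] of the gaps
    between the arithmetic mean and the geometric, respectively power, mean.

    For fixed [t] this ratio is monotone in [w].  The gaps vanish at [w = 0] and [w = 1],
    and the ratio of their second derivatives in [w] has the shape
    [exp (w t) L(w)^(2 - 1/alpha)] with [L] affine.  For [alpha > 1/2] it is decreasing on
    [(0, 1)], and counting the zeros of [A - c B] shows that [A / B] is monotone too.  For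
    [alpha < 1/2] only [w < 1/2] matters, and the missing boundary information is the sign
    of the derivative of [A / B] at [w = 1/2], a hyperbolic inequality in [t = - 2 u].

    Since the extrema over [t] are attained (third-order expansion at [t = 0], where
    [A / B] tends to [1/(1 - alpha)], and exponential asymptotics at [t = - oo]), comparing
    two weights at the extremal [t] of one of them gives strict monotonicity in [n]. *)

From Stdlib Require Import Reals Lra Lia Psatz ClassicalEpsilon.
From Coquelicot Require Import Coquelicot.
Require Import Defs.
Open Scope R_scope.

(** The bounds on [n] in parts 3 and 4 are conditions on the weight. Near [t = - oo] the ratio
    differs from its limit by a term of order [exp (w t)] from the geometric mean and one of order
    [exp (alpha t)] from the power mean, with opposite effects when [0 < alpha < 1]. For
    [w = 1 - 1/n], [n < 1/(1 - alpha)] means [w < alpha]; for [w = 1/n], [n < 1/alpha] means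
    [w > alpha]. In each case the winning term carries the ratio past its limit in the direction of
    the extremum. At [t = 0] the direction is decided by the sign of [1 - 2 w], hence the choice of
    the interval on which [f] is studied.

    For [alpha < 0] the logarithm of the ratio of second derivatives is concave in [w] and need not
    be monotone, so one sign change is no contradiction; an extra point is taken from the other half
    [w > 1/2]. The hyperbolic inequality for [0 < alpha <= 1/2] splits into two inequalities that
    are multiplied together; [alpha <= 1/2] enters as [1/alpha >= 2].

    Passing from [nu] to [omega] reverses the order because [nu] stays on one side of [1]. *)

(** * Calculus *)

Lemma mean_value (phi dphi : R -> R) (a b : R) :
  a < b -> (forall x, a <= x <= b -> is_derive phi x (dphi x)) ->
  exists c, a < c < b /\ phi b - phi a = dphi c * (b - a).
Proof.
  intros Hab Hd.
  destruct (MVT_cor2 phi dphi a b Hab) as [c [Hc Hin]].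
  - intros c Hc. apply is_derive_Reals. now apply Hd.
  - exists c. now split.
Qed.

Lemma mean_value_nonneg (phi dphi : R -> R) (a b : R) :
  a < b -> (forall x, a <= x <= b -> is_derive phi x (dphi x)) ->
  phi a <= phi b -> exists c, a < c < b /\ 0 <= dphi c.
Proof.
  intros Hab Hd Hle.
  destruct (mean_value phi dphi a b Hab Hd) as [c [Hc E]].
  exists c. split; [exact Hc|]. nra.
Qed.

Lemma mean_value_nonpos (phi dphi : R -> R) (a b : R) :
  a < b -> (forall x, a <= x <= b -> is_derive phi x (dphi x)) ->
  phi b <= phi a -> exists c, a < c < b /\ dphi c <= 0.
Proof.
  intros Hab Hd Hle.
  destruct (mean_value phi dphi a b Hab Hd) as [c [Hc E]].
  exists c. split; [exact Hc|]. nra.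
Qed.

Lemma derive_pos_increasing (phi dphi : R -> R) (a b : R) :
  a < b -> (forall x, a <= x <= b -> is_derive phi x (dphi x)) ->
  (forall x, a < x < b -> 0 < dphi x) -> phi a < phi b.
Proof.
  intros Hab Hd Hpos.
  destruct (mean_value phi dphi a b Hab Hd) as [c [Hc E]].
  specialize (Hpos c Hc). nra.
Qed.

Lemma derive_nonneg_nondecreasing (phi dphi : R -> R) (a b : R) :
  a <= b -> (forall x, a <= x <= b -> is_derive phi x (dphi x)) ->
  (forall x, a < x < b -> 0 <= dphi x) -> phi a <= phi b.
Proof.
  intros Hab Hd Hpos.
  destruct (Req_dec a b) as [->|Hne]; [lra|].
  destruct (mean_value phi dphi a b) as [c [Hc E]]; [lra|exact Hd|].
  specialize (Hpos c Hc). nra.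
Qed.

Lemma concave_vanishing_ends_pos (D D1 D2 : R -> R) (a b x : R) :
  a < x < b ->
  (forall y, a <= y <= b -> is_derive D y (D1 y)) ->
  (forall y, a <= y <= b -> is_derive D1 y (D2 y)) ->
  (forall y, a < y < b -> D2 y < 0) ->
  D a = 0 -> D b = 0 -> 0 < D x.
Proof.
  intros Hx H1 H2 Hneg Ha Hb.
  destruct (Rlt_or_le 0 (D x)) as [|Hle]; [assumption|exfalso].
  destruct (mean_value_nonpos D D1 a x) as [c [Hc Dc]];
    [lra|intros; apply H1; lra|lra|].
  destruct (mean_value_nonneg D D1 x b) as [d [Hd Dd]];
    [lra|intros; apply H1; lra|lra|].
  destruct (mean_value_nonneg D1 D2 c d) as [e [He De]];
    [lra|intros; apply H2; lra|lra|].
  specialize (Hneg e). lra.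
Qed.

(** [D] rises, falls and rises again, all weakly; the mean value theorem gives slopes of signs
    [+ - +], then second derivatives of signs [- +]. This replaces a count of zeros with
    multiplicity. *)
Lemma second_derivative_sign_change (D D1 D2 : R -> R) (x0 x1 x2 x3 : R) :
  x0 < x1 -> x1 < x2 -> x2 < x3 ->
  (forall y, x0 <= y <= x3 -> is_derive D y (D1 y)) ->
  (forall y, x0 <= y <= x3 -> is_derive D1 y (D2 y)) ->
  D x0 <= D x1 -> D x2 <= D x1 -> D x2 <= D x3 ->
  exists y z, x0 < y < z /\ z < x3 /\ D2 y <= 0 /\ 0 <= D2 z.
Proof.
  intros L1 L2 L3 H1 H2 E1 E2 E3.
  destruct (mean_value_nonneg D D1 x0 x1) as [c1 [I1 S1]];
    [lra|intros; apply H1; lra|lra|].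
  destruct (mean_value_nonpos D D1 x1 x2) as [c2 [I2 S2]];
    [lra|intros; apply H1; lra|lra|].
  destruct (mean_value_nonneg D D1 x2 x3) as [c3 [I3 S3]];
    [lra|intros; apply H1; lra|lra|].
  destruct (mean_value_nonpos D1 D2 c1 c2) as [y [Iy Sy]];
    [lra|intros; apply H2; lra|lra|].
  destruct (mean_value_nonneg D1 D2 c2 c3) as [z [Iz Sz]];
    [lra|intros; apply H2; lra|lra|].
  exists y, z. repeat split; lra.
Qed.

(** Variant for an end where the available information is a slope instead of a further value. *)
Lemma second_derivative_sign_change_slope (D D1 D2 : R -> R) (x0 x1 x2 : R) :
  x0 < x1 -> x1 < x2 ->
  (forall y, x0 <= y <= x2 -> is_derive D y (D1 y)) ->
  (forall y, x0 <= y <= x2 -> is_derive D1 y (D2 y)) ->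
  D x0 <= D x1 -> D x2 <= D x1 -> 0 <= D1 x2 ->
  exists y z, x0 < y < z /\ z < x2 /\ D2 y <= 0 /\ 0 <= D2 z.
Proof.
  intros L1 L2 H1 H2 E1 E2 E3.
  destruct (mean_value_nonneg D D1 x0 x1) as [c1 [I1 S1]];
    [lra|intros; apply H1; lra|lra|].
  destruct (mean_value_nonpos D D1 x1 x2) as [c2 [I2 S2]];
    [lra|intros; apply H1; lra|lra|].
  destruct (mean_value_nonpos D1 D2 c1 c2) as [y [Iy Sy]];
    [lra|intros; apply H2; lra|lra|].
  destruct (mean_value_nonneg D1 D2 c2 x2) as [z [Iz Sz]];
    [lra|intros; apply H2; lra|lra|].
  exists y, z. repeat split; lra.
Qed.

Lemma continuous_pos_near_left (psi : R -> R) (a : R) :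
  continuous psi a -> 0 < psi a ->
  exists d, 0 < d /\ forall x, a - d < x <= a -> 0 < psi x.
Proof.
  intros Hc Hp.
  destruct (Hc (fun y => 0 < y)) as [d Hd].
  - exists (mkposreal _ Hp). intros y Hy. unfold ball in Hy; simpl in Hy.
    unfold AbsRing_ball, abs, minus, plus, opp in Hy; simpl in Hy.
    apply Rabs_def2 in Hy. lra.
  - exists d. split; [apply cond_pos|]. intros x Hx. apply Hd.
    unfold ball; simpl. unfold AbsRing_ball, abs, minus, plus, opp; simpl.
    apply Rabs_def1; lra.
Qed.

Lemma second_order_pos_left (D D1 D2 : R -> R) :
  (forall x, is_derive D x (D1 x)) -> (forall x, is_derive D1 x (D2 x)) ->
  continuous D2 0 -> D 0 = 0 -> D1 0 = 0 -> 0 < D2 0 ->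
  exists d, 0 < d /\ forall x, - d < x < 0 -> 0 < D x.
Proof.
  intros H1 H2 Hc E0 E1 E2.
  destruct (continuous_pos_near_left D2 0 Hc E2) as [d [Hd Hp]].
  exists d. split; [exact Hd|]. intros x Hx.
  destruct (mean_value D D1 x 0) as [c [Ic Ec]]; [lra|intros; apply H1|].
  destruct (mean_value D1 D2 c 0) as [e [Ie Ee]]; [lra|intros; apply H2|].
  assert (0 < D2 e) by (apply Hp; lra).
  assert (D1 c < 0) by nra. nra.
Qed.

(** Second-order positivity applied to [D1] makes [D] increase up to its zero at [0]. *)
Lemma third_order_neg_left (D D1 D2 D3 : R -> R) :
  (forall x, is_derive D x (D1 x)) -> (forall x, is_derive D1 x (D2 x)) ->
  (forall x, is_derive D2 x (D3 x)) ->
  continuous D3 0 -> D 0 = 0 -> D1 0 = 0 -> D2 0 = 0 -> 0 < D3 0 ->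
  exists d, 0 < d /\ forall x, - d < x < 0 -> D x < 0.
Proof.
  intros H1 H2 H3 Hc E0 E1 E2 E3.
  destruct (second_order_pos_left D1 D2 D3 H2 H3 Hc E1 E2 E3) as [d [Hd Hp]].
  exists d. split; [exact Hd|]. intros x Hx.
  destruct (mean_value D D1 x 0) as [c [Ic Ec]]; [lra|intros; apply H1|].
  assert (0 < D1 c) by (apply Hp; lra). nra.
Qed.

(** The bounds near the two open ends reduce the search to a compact interval containing both [x0]
    and [x1]. *)
Lemma min_on_negative_reals (phi : R -> R) (x0 x1 d M : R) :
  (forall x, x < 0 -> continuous phi x) -> x0 < 0 -> x1 < 0 -> 0 < d ->
  (forall x, - d < x < 0 -> phi x0 <= phi x) ->
  (forall x, x < M -> phi x1 <= phi x) ->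
  exists x, x < 0 /\ forall y, y < 0 -> phi x <= phi y.
Proof.
  intros Hc H0 H1 Hd Hnear Hfar.
  set (lo := Rmin (M - 1) (Rmin x0 x1)).
  set (hi := Rmax (- d / 2) (Rmax x0 x1)).
  assert (Hlo : lo <= M - 1 /\ lo <= x0 /\ lo <= x1).
  { unfold lo. generalize (Rmin_l (M - 1) (Rmin x0 x1)) (Rmin_r (M - 1) (Rmin x0 x1))
      (Rmin_l x0 x1) (Rmin_r x0 x1). lra. }
  assert (Hhi : - d / 2 <= hi /\ x0 <= hi /\ x1 <= hi /\ hi < 0).
  { unfold hi. generalize (Rmax_l (- d / 2) (Rmax x0 x1)) (Rmax_r (- d / 2) (Rmax x0 x1))
      (Rmax_l x0 x1) (Rmax_r x0 x1). intros.
    repeat split; try lra. repeat apply Rmax_lub_lt; lra. }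
  destruct (continuity_ab_min phi lo hi) as [x [Hx Ix]]; [lra| |].
  { intros y Hy. apply continuity_pt_filterlim. apply Hc. lra. }
  exists x. split; [lra|]. intros y Hy.
  destruct (Rlt_or_le y lo).
  { apply Rle_trans with (phi x1); [apply Hx; lra|apply Hfar; lra]. }
  destruct (Rlt_or_le hi y).
  { apply Rle_trans with (phi x0); [apply Hx; lra|apply Hnear; lra]. }
  apply Hx; lra.
Qed.

(** * Extrema of ratios, and the gaps *)

Lemma exp_small_near_minus_infty (k e : R) :
  0 < k -> 0 < e -> exists M, forall x, x < M -> exp (k * x) < e.
Proof.
  intros Hk He. exists (ln e / k). intros x Hx.
  rewrite <- (exp_ln e He) at 1. apply exp_increasing.
  replace (ln e) with (k * (ln e / k)) by (field; lra). nra.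
Qed.

(** The infimum is not lost at either end. Just left of [0] the third-order term makes [U - c V]
    negative, so the ratio goes strictly below its limit [c]. At [- oo] the limit [U0 / V0] is
    already undercut at [x1]. *)
Lemma ratio_min_exists (U U1 U2 U3 V V1 V2 V3 : R -> R) (c U0 V0 C k x1 : R) :
  (forall x, is_derive U x (U1 x)) -> (forall x, is_derive U1 x (U2 x)) ->
  (forall x, is_derive U2 x (U3 x)) -> continuous U3 0 ->
  (forall x, is_derive V x (V1 x)) -> (forall x, is_derive V1 x (V2 x)) ->
  (forall x, is_derive V2 x (V3 x)) -> continuous V3 0 ->
  U 0 = 0 -> U1 0 = 0 -> V 0 = 0 -> V1 0 = 0 -> 0 < V2 0 ->
  U2 0 = c * V2 0 -> c * V3 0 < U3 0 ->
  (forall x, x < 0 -> 0 < U x) -> (forall x, x < 0 -> 0 < V x) -> 0 < V0 -> 0 < k ->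
  (forall x, x < 0 -> Rabs (U x - U0) <= C * exp (k * x)) ->
  (forall x, x < 0 -> Rabs (V x - V0) <= C * exp (k * x)) ->
  x1 < 0 -> U x1 * V0 < U0 * V x1 ->
  exists x, x < 0 /\ forall y, y < 0 -> U x / V x <= U y / V y.
Proof.
  intros HU HU1 HU2 HU3 HV HV1 HV2 HV3 EU EU1 EV EV1 EV2 E2 E3 Upos Vpos PV0 Hk
    FU FV Hx1 Fx1.
  assert (Hc : forall j, forall x, is_derive (fun x => U x - j * V x) x (U1 x - j * V1 x)).
  { intros j x. apply (is_derive_minus U (fun x => j * V x)); [apply HU|].
    apply (is_derive_scal V); apply HV. }
  assert (Hc1 : forall j, forall x, is_derive (fun x => U1 x - j * V1 x) x (U2 x - j * V2 x)).
  { intros j x. apply (is_derive_minus U1 (fun x => j * V1 x)); [apply HU1|].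
    apply (is_derive_scal V1); apply HV1. }
  assert (Hc2 : forall j, forall x, is_derive (fun x => U2 x - j * V2 x) x (U3 x - j * V3 x)).
  { intros j x. apply (is_derive_minus U2 (fun x => j * V2 x)); [apply HU2|].
    apply (is_derive_scal V2); apply HV2. }
  destruct (third_order_neg_left (fun x => U x - c * V x) (fun x => U1 x - c * V1 x)
    (fun x => U2 x - c * V2 x) (fun x => U3 x - c * V3 x)) as [d [Hd Hneg]];
    try apply Hc; try apply Hc1; try apply Hc2; try (cbv beta; nra).
  { apply (continuous_minus U3 (fun x => c * V3 x)); [exact HU3|].
    apply (continuous_scal_r c V3). exact HV3. }
  set (x0 := - d / 2). assert (Hx0 : - d < x0 < 0) by (unfold x0; lra).
  specialize (Hneg x0 Hx0). cbv beta in Hneg.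
  (* Since [j < c], the second derivative of [U - j V] at [0] is [(c - j) V2(0) > 0]; near [0] the
     ratio therefore exceeds its value at [x0]. *)
  set (j := U x0 / V x0).
  assert (PV := Vpos x0 ltac:(lra)).
  assert (Ej : j * V x0 = U x0) by (unfold j; field; lra).
  destruct (second_order_pos_left (fun x => U x - j * V x) (fun x => U1 x - j * V1 x)
    (fun x => U2 x - j * V2 x)) as [e [He Hpos]];
    try apply Hc; try apply Hc1; try (cbv beta; nra).
  { eapply (ex_derive_continuous (fun x => U2 x - j * V2 x)).
    eexists; apply Hc2. }
  set (i := U x1 / V x1).
  assert (PV1 := Vpos x1 Hx1).
  assert (Ei : i * V x1 = U x1) by (unfold i; field; lra).
  assert (Hi : 0 < i) by (unfold i; apply Rdiv_lt_0_compat; auto).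
  assert (Gi : 0 < U0 - i * V0) by nra.
  assert (PC : 0 <= C).
  { generalize (FU (-1) ltac:(lra)) (Rabs_pos (U (-1) - U0)) (exp_pos (k * -1)). nra. }
  (* Beyond [M] the errors [C exp (k x)] in [U] and in [i V] together stay below [U0 - i V0];
     [1 + C] keeps the denominator positive if [C = 0]. *)
  destruct (exp_small_near_minus_infty k ((U0 - i * V0) / ((1 + C) * (1 + i)))) as [M HM];
    [exact Hk|apply Rdiv_lt_0_compat; nra|].
  apply (min_on_negative_reals (fun x => U x / V x) x0 x1 e (Rmin M 0)); auto; try lra.
  - intros x Hx. apply (ex_derive_continuous (fun x => U x / V x)).
    exists ((U1 x * V x - U x * V1 x) / V x ^ 2).
    apply is_derive_div; [apply HU|apply HV|]. specialize (Vpos x Hx). lra.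
  - intros x Hx. fold j. specialize (Hpos x Hx). cbv beta in Hpos.
    assert (PVx := Vpos x ltac:(lra)).
    apply (proj1 (Rle_div_r _ _ _ PVx)); lra.
  - intros x Hx. fold i.
    assert (x < M) by (generalize (Rmin_l M 0); lra).
    assert (x < 0) by (generalize (Rmin_r M 0); lra).
    assert (PVx := Vpos x ltac:(lra)).
    apply (proj1 (Rle_div_r _ _ _ PVx)).
    assert (AU := FU x ltac:(lra)). assert (AV := FV x ltac:(lra)).
    apply Rabs_le_between in AU. apply Rabs_le_between in AV.
    assert (AM := HM x ltac:(lra)).
    apply (Rlt_div_r _ _ ((1 + C) * (1 + i))) in AM; [|nra].
    assert (Pe := exp_pos (k * x)). nra.
Qed.

(* Means of the values [1] and [exp t] with weights [1 - w] and [w]; the power mean is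
   [pow_base ^ (1 / alpha)]. *)
Definition arith_mean (w t : R) : R := 1 - w + w * exp t.
Definition pow_base (alpha w t : R) : R := 1 - w + w * exp (alpha * t).
Definition geom_gap (w t : R) : R := arith_mean w t - exp (w * t).
Definition pow_gap (alpha w t : R) : R :=
  arith_mean w t - exp (ln (pow_base alpha w t) / alpha).

Lemma weighted_exp_pos (w v : R) : 0 <= w <= 1 -> 0 < 1 - w + w * exp v.
Proof.
  intros Hw. assert (H := exp_pos v).
  destruct (Req_dec w 1) as [->|]; [lra|nra].
Qed.

Lemma pow_base_pos (alpha w t : R) : 0 <= w <= 1 -> 0 < pow_base alpha w t.
Proof. apply weighted_exp_pos. Qed.

Lemma exp_ln_shift (L x : R) : 0 < L -> exp (ln L * (x - 1)) = exp (ln L * x) / L.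
Proof.
  intros HL. replace (ln L * (x - 1)) with (ln L * x + - ln L) by ring.
  rewrite exp_plus, exp_Ropp, exp_ln by exact HL. reflexivity.
Qed.

(* [pow_base ^ (1 / alpha - j)] *)
Definition pow_factor (alpha w t j : R) : R :=
  exp (ln (pow_base alpha w t) * (1 / alpha - j)).

Lemma pow_factor_pos (alpha w t j : R) : 0 < pow_factor alpha w t j.
Proof. apply exp_pos. Qed.

(** Each differentiation lowers the exponent [1 / alpha - j] by one, so the family indexed by [j] is
    closed under derivatives in [t] and in [w]. *)
Lemma pow_factor_succ (alpha w t j : R) : 0 <= w <= 1 ->
  pow_factor alpha w t (j + 1) = pow_factor alpha w t j / pow_base alpha w t.
Proof.
  intros Hw. unfold pow_factor.
  rewrite <- (exp_ln_shift (pow_base alpha w t)) by now apply pow_base_pos.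
  f_equal; ring.
Qed.

Lemma pow_factor_0 (alpha w t : R) :
  exp (ln (pow_base alpha w t) / alpha) = pow_factor alpha w t 0.
Proof. unfold pow_factor. f_equal. unfold Rdiv. ring. Qed.

Lemma is_derive_pow_factor_t (alpha w j t : R) : 0 <= w <= 1 -> alpha <> 0 ->
  is_derive (fun t => pow_factor alpha w t j) t
    ((1 - j * alpha) * w * exp (alpha * t) * pow_factor alpha w t (j + 1)).
Proof.
  intros Hw Ha. rewrite pow_factor_succ by exact Hw.
  assert (HL := pow_base_pos alpha w t Hw).
  unfold pow_factor, pow_base in *. auto_derive; [exact HL|]. field; lra.
Qed.

Lemma is_derive_pow_factor_w (alpha w j t : R) : 0 <= w <= 1 -> alpha <> 0 ->
  is_derive (fun w => pow_factor alpha w t j) w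
    ((1 / alpha - j) * (exp (alpha * t) - 1) * pow_factor alpha w t (j + 1)).
Proof.
  intros Hw Ha. rewrite pow_factor_succ by exact Hw.
  assert (HL := pow_base_pos alpha w t Hw).
  unfold pow_factor, pow_base in *. auto_derive; [exact HL|].
  replace (1 + - w) with (1 - w) by ring. field; lra.
Qed.

(** Three orders are needed: at [t = 0] both gaps vanish with their first derivatives, and the
    second derivatives only fix the limit of the ratio. *)
Definition geom_gap_t1 (w t : R) : R := w * exp t - w * exp (w * t).
Definition geom_gap_t2 (w t : R) : R := w * exp t - w ^ 2 * exp (w * t).
Definition geom_gap_t3 (w t : R) : R := w * exp t - w ^ 3 * exp (w * t).

Definition pow_gap_t1 (alpha w t : R) : R :=
  w * exp t - w * (exp (alpha * t) * pow_factor alpha w t 1).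
Definition pow_gap_t2 (alpha w t : R) : R :=
  w * exp t - w * (alpha * exp (alpha * t) * pow_factor alpha w t 1
    + (1 - alpha) * w * exp (alpha * t) ^ 2 * pow_factor alpha w t 2).
Definition pow_gap_t3 (alpha w t : R) : R :=
  w * exp t - w * (alpha ^ 2 * exp (alpha * t) * pow_factor alpha w t 1
    + 3 * alpha * (1 - alpha) * w * exp (alpha * t) ^ 2 * pow_factor alpha w t 2
    + (1 - alpha) * (1 - 2 * alpha) * w ^ 2 * exp (alpha * t) ^ 3
      * pow_factor alpha w t 3).

Lemma is_derive_geom_gap_t (w t : R) :
  is_derive (geom_gap w) t (geom_gap_t1 w t) /\
  is_derive (geom_gap_t1 w) t (geom_gap_t2 w t) /\
  is_derive (geom_gap_t2 w) t (geom_gap_t3 w t).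
Proof.
  unfold geom_gap, arith_mean, geom_gap_t1, geom_gap_t2, geom_gap_t3.
  split; [|split]; auto_derive; auto; ring.
Qed.

Lemma is_derive_pow_gap_t (alpha w t : R) : 0 <= w <= 1 -> alpha <> 0 ->
  is_derive (pow_gap alpha w) t (pow_gap_t1 alpha w t) /\
  is_derive (pow_gap_t1 alpha w) t (pow_gap_t2 alpha w t) /\
  is_derive (pow_gap_t2 alpha w) t (pow_gap_t3 alpha w t).
Proof.
  intros Hw Ha.
  assert (Hq : forall j, is_derive (fun t => pow_factor alpha w t j) t
    ((1 - j * alpha) * w * exp (alpha * t) * pow_factor alpha w t (j + 1)))
    by (intros; now apply is_derive_pow_factor_t).
  assert (Dq : forall j l, is_derive (fun t => pow_factor alpha w t j) t l ->
    Derive (fun t : R => pow_factor alpha w t j) t = l)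
    by (intros; now apply is_derive_unique).
  assert (E2 : 1 + 1 = 2) by ring. assert (E3 : 2 + 1 = 3) by ring.
  split; [|split].
  - apply (is_derive_ext (fun t => arith_mean w t - pow_factor alpha w t 0)).
    { intros x. unfold pow_gap. now rewrite pow_factor_0. }
    assert (H := Hq 0). rewrite Rplus_0_l in H.
    unfold arith_mean, pow_gap_t1. auto_derive.
    { eexists; exact H. }
    rewrite (Dq _ _ H). ring.
  - assert (H := Hq 1). rewrite E2 in H.
    unfold pow_gap_t1, pow_gap_t2. auto_derive.
    { eexists; exact H. }
    rewrite (Dq _ _ H). ring.
  - assert (H1 := Hq 1). rewrite E2 in H1. assert (H2 := Hq 2). rewrite E3 in H2.
    unfold pow_gap_t2, pow_gap_t3. auto_derive.
    { repeat split; eexists; [exact H1|exact H2]. }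
    rewrite (Dq _ _ H1), (Dq _ _ H2). ring.
Qed.

Definition geom_gap_w1 (t w : R) : R := exp t - 1 - t * exp (w * t).
Definition geom_gap_w2 (t w : R) : R := - (t ^ 2 * exp (w * t)).
Definition pow_gap_w1 (alpha t w : R) : R :=
  exp t - 1 - (exp (alpha * t) - 1) / alpha * pow_factor alpha w t 1.
Definition pow_gap_w2 (alpha t w : R) : R :=
  - ((1 - alpha) * ((exp (alpha * t) - 1) / alpha) ^ 2 * pow_factor alpha w t 2).

Lemma is_derive_geom_gap_w (w t : R) :
  is_derive (fun w => geom_gap w t) w (geom_gap_w1 t w) /\
  is_derive (geom_gap_w1 t) w (geom_gap_w2 t w).
Proof.
  unfold geom_gap, arith_mean, geom_gap_w1, geom_gap_w2.
  split; auto_derive; auto; ring.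
Qed.

Lemma is_derive_pow_gap_w (alpha w t : R) : 0 <= w <= 1 -> alpha <> 0 ->
  is_derive (fun w => pow_gap alpha w t) w (pow_gap_w1 alpha t w) /\
  is_derive (pow_gap_w1 alpha t) w (pow_gap_w2 alpha t w).
Proof.
  intros Hw Ha.
  assert (Hq : forall j, is_derive (fun w => pow_factor alpha w t j) w
    ((1 / alpha - j) * (exp (alpha * t) - 1) * pow_factor alpha w t (j + 1)))
    by (intros; now apply is_derive_pow_factor_w).
  assert (Dq : forall j l, is_derive (fun w => pow_factor alpha w t j) w l ->
    Derive (fun w : R => pow_factor alpha w t j) w = l)
    by (intros; now apply is_derive_unique).
  split.
  - apply (is_derive_ext (fun w => arith_mean w t - pow_factor alpha w t 0)).
    { intros x. unfold pow_gap. now rewrite pow_factor_0. }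
    assert (H := Hq 0). rewrite Rplus_0_l in H.
    unfold arith_mean, pow_gap_w1. auto_derive.
    { eexists; exact H. }
    rewrite (Dq _ _ H). field; exact Ha.
  - assert (H := Hq 1). replace (1 + 1) with 2 in H by ring.
    unfold pow_gap_w1, pow_gap_w2. auto_derive.
    { eexists; exact H. }
    rewrite (Dq _ _ H). field; exact Ha.
Qed.

(** * Signs of the gaps, hyperbolic inequalities *)

Lemma geom_gap_0 (t : R) : geom_gap 0 t = 0.
Proof. unfold geom_gap, arith_mean. rewrite !Rmult_0_l, exp_0. ring. Qed.

Lemma geom_gap_1 (t : R) : geom_gap 1 t = 0.
Proof. unfold geom_gap, arith_mean. rewrite !Rmult_1_l. ring. Qed.

Lemma pow_gap_0 (alpha t : R) : pow_gap alpha 0 t = 0.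
Proof.
  unfold pow_gap, arith_mean, pow_base.
  replace (1 - 0 + 0 * exp (alpha * t)) with 1 by ring.
  rewrite ln_1. unfold Rdiv. rewrite !Rmult_0_l, exp_0. ring.
Qed.

Lemma pow_gap_1 (alpha t : R) : alpha <> 0 -> pow_gap alpha 1 t = 0.
Proof.
  intros Ha. unfold pow_gap, arith_mean, pow_base.
  replace (1 - 1 + 1 * exp (alpha * t)) with (exp (alpha * t)) by ring.
  rewrite ln_exp. replace (alpha * t / alpha) with t by (field; exact Ha). ring.
Qed.

Lemma geom_gap_pos (w t : R) : 0 < w < 1 -> t <> 0 -> 0 < geom_gap w t.
Proof.
  intros Hw Ht.
  apply (concave_vanishing_ends_pos (fun w => geom_gap w t) (geom_gap_w1 t)
    (geom_gap_w2 t) 0 1 w Hw).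
  - intros; apply is_derive_geom_gap_w.
  - intros; apply is_derive_geom_gap_w.
  - intros y _. unfold geom_gap_w2. assert (H := exp_pos (y * t)).
    assert (0 < t ^ 2) by nra. nra.
  - apply geom_gap_0.
  - apply geom_gap_1.
Qed.

Lemma exp_neq_1 (x : R) : x <> 0 -> exp x <> 1.
Proof. intros Hx E. apply Hx, exp_inv. now rewrite exp_0. Qed.

Lemma pow_coeff_pos (alpha t : R) : alpha <> 0 -> t <> 0 ->
  0 < ((exp (alpha * t) - 1) / alpha) ^ 2.
Proof.
  intros Ha Ht. apply pow2_gt_0. intros E.
  apply (exp_neq_1 (alpha * t)).
  { now apply Rmult_integral_contrapositive. }
  replace (exp (alpha * t)) with ((exp (alpha * t) - 1) / alpha * alpha + 1)
    by (field; exact Ha).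
  rewrite E. ring.
Qed.

(** In [w] the second derivative has the sign of [alpha - 1]: the gap is concave here and convex for
    [alpha > 1], with zeros at both ends. *)
Lemma pow_gap_pos (alpha w t : R) :
  0 < w < 1 -> t <> 0 -> alpha <> 0 -> alpha < 1 -> 0 < pow_gap alpha w t.
Proof.
  intros Hw Ht Ha Ha1.
  apply (concave_vanishing_ends_pos (fun w => pow_gap alpha w t) (pow_gap_w1 alpha t)
    (pow_gap_w2 alpha t) 0 1 w Hw).
  - intros; now apply is_derive_pow_gap_w.
  - intros; now apply is_derive_pow_gap_w.
  - intros y _. unfold pow_gap_w2. assert (H := pow_factor_pos alpha y t 2).
    assert (H2 := pow_coeff_pos alpha t Ha Ht).
    assert (0 < (1 - alpha) * ((exp (alpha * t) - 1) / alpha) ^ 2) by nra. nra.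
  - apply pow_gap_0.
  - now apply pow_gap_1.
Qed.

Lemma pow_gap_neg (alpha w t : R) :
  0 < w < 1 -> t <> 0 -> 1 < alpha -> pow_gap alpha w t < 0.
Proof.
  intros Hw Ht Ha.
  enough (0 < - pow_gap alpha w t) by lra.
  apply (concave_vanishing_ends_pos (fun w => - pow_gap alpha w t)
    (fun w => - pow_gap_w1 alpha t w) (fun w => - pow_gap_w2 alpha t w) 0 1 w Hw).
  - intros; apply (is_derive_opp (fun w => pow_gap alpha w t)), is_derive_pow_gap_w; lra.
  - intros; apply (is_derive_opp (pow_gap_w1 alpha t)), is_derive_pow_gap_w; lra.
  - intros y _. unfold pow_gap_w2. assert (H := pow_factor_pos alpha y t 2).
    assert (H2 := pow_coeff_pos alpha t ltac:(lra) Ht).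
    assert (0 < (alpha - 1) * ((exp (alpha * t) - 1) / alpha) ^ 2) by nra. nra.
  - rewrite pow_gap_0. ring.
  - rewrite pow_gap_1; lra.
Qed.

(** Weighted AM-GM for the values [1] and [exp (alpha * t)], in logarithmic form; dividing by
    [alpha] compares the power mean with the geometric mean. *)
Lemma ln_pow_base_gt (alpha w t : R) : 0 < w < 1 -> alpha <> 0 -> t <> 0 ->
  w * (alpha * t) < ln (pow_base alpha w t).
Proof.
  intros Hw Ha Ht.
  assert (H : 0 < geom_gap w (alpha * t)).
  { apply geom_gap_pos; [exact Hw|]. now apply Rmult_integral_contrapositive. }
  unfold geom_gap, arith_mean in H.
  rewrite <- (ln_exp (w * (alpha * t))).
  apply ln_increasing; [apply exp_pos|]. unfold pow_base. lra.
Qed.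

Lemma pow_gap_lt_geom_gap (alpha w t : R) : 0 < w < 1 -> 0 < alpha -> t <> 0 ->
  pow_gap alpha w t < geom_gap w t.
Proof.
  intros Hw Ha Ht. unfold pow_gap, geom_gap.
  enough (exp (w * t) < exp (ln (pow_base alpha w t) / alpha)) by lra.
  apply exp_increasing. apply (proj1 (Rlt_div_r _ _ _ Ha)).
  generalize (ln_pow_base_gt alpha w t Hw ltac:(lra) Ht). nra.
Qed.

Lemma geom_gap_lt_pow_gap (alpha w t : R) : 0 < w < 1 -> alpha < 0 -> t <> 0 ->
  geom_gap w t < pow_gap alpha w t.
Proof.
  intros Hw Ha Ht. unfold pow_gap, geom_gap.
  enough (exp (ln (pow_base alpha w t) / alpha) < exp (w * t)) by lra.
  apply exp_increasing.
  replace (ln (pow_base alpha w t) / alpha) with (- ln (pow_base alpha w t) / - alpha)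
    by (field; lra).
  apply (proj2 (Rlt_div_l _ _ (- alpha) ltac:(lra))).
  generalize (ln_pow_base_gt alpha w t Hw ltac:(lra) Ht). nra.
Qed.

(** * Hyperbolic inequalities and the derivative at the weight 1/2 *)

Lemma is_derive_sinh (x : R) : is_derive sinh x (cosh x).
Proof. apply is_derive_Reals, derivable_pt_lim_sinh. Qed.

Lemma is_derive_cosh (x : R) : is_derive cosh x (sinh x).
Proof. apply is_derive_Reals, derivable_pt_lim_cosh. Qed.

Lemma cosh_sqr_sinh (x : R) : cosh x ^ 2 = 1 + sinh x ^ 2.
Proof.
  unfold cosh, sinh. rewrite exp_Ropp. assert (H := exp_pos x). field; lra.
Qed.

Lemma sinh_pos (x : R) : 0 < x -> 0 < sinh x.
Proof.
  intros Hx. unfold sinh. assert (exp (- x) < exp x) by (apply exp_increasing; lra). lra.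
Qed.

Lemma cosh_pos (x : R) : 0 < cosh x.
Proof. unfold cosh. generalize (exp_pos x) (exp_pos (- x)). lra. Qed.

Lemma cosh_gt_1 (x : R) : 0 < x -> 1 < cosh x.
Proof.
  intros Hx. generalize (cosh_sqr_sinh x) (sinh_pos x Hx) (cosh_pos x). nra.
Qed.

Lemma sinh_gt_id (x : R) : 0 < x -> x < sinh x.
Proof.
  intros Hx.
  assert (H : sinh 0 - 0 < sinh x - x).
  { apply (derive_pos_increasing (fun x => sinh x - x) (fun x => cosh x - 1)); [lra| |].
    - intros. apply (is_derive_minus sinh (fun x => x)); [apply is_derive_sinh|].
      apply @is_derive_id.
    - intros y Hy. generalize (cosh_gt_1 y). lra. }
  rewrite sinh_0 in H. lra.
Qed.

Lemma sinh_lt_id_cosh (x : R) : 0 < x -> sinh x < x * cosh x.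
Proof.
  intros Hx.
  assert (H : 0 * cosh 0 - sinh 0 < x * cosh x - sinh x).
  { apply (derive_pos_increasing (fun x => x * cosh x - sinh x) (fun x => x * sinh x)); [lra| |].
    - intros y Hy. unfold sinh, cosh. auto_derive; [auto|field].
    - intros y Hy. generalize (sinh_pos y). nra. }
  rewrite sinh_0 in H. lra.
Qed.

(** The derivative of this Langevin function is [1 / x ^ 2 - 1 / sinh x ^ 2], nonnegative because
    [sinh x > x]. *)
Lemma langevin_nondecreasing (x y : R) : 0 < x <= y ->
  cosh x / sinh x - 1 / x <= cosh y / sinh y - 1 / y.
Proof.
  intros Hxy.
  apply (derive_nonneg_nondecreasing (fun x => cosh x / sinh x - 1 / x)
    (fun x => (sinh x * sinh x - cosh x * cosh x) / sinh x ^ 2 - - (1 / x ^ 2))); [lra| |].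
  - intros z Hz. assert (H := sinh_pos z ltac:(lra)).
    apply (is_derive_minus (fun x => cosh x / sinh x) (fun x => 1 / x)).
    + apply is_derive_div; [apply is_derive_cosh|apply is_derive_sinh|lra].
    + auto_derive; [lra|field; lra].
  - intros z Hz. assert (H := sinh_gt_id z ltac:(lra)).
    replace (sinh z * sinh z - cosh z * cosh z) with (- (1))
      by (generalize (cosh_sqr_sinh z); nra).
    enough (/ sinh z ^ 2 <= / z ^ 2) by (unfold Rdiv; lra).
    apply Rinv_le_contravar; nra.
Qed.

(** [sinh (rho x) / sinh x] is nondecreasing: the numerator of its derivative vanishes at [0] and
    has derivative [(rho ^ 2 - 1) sinh (rho x) sinh x >= 0]. *)
Lemma sinh_scale_ratio (rho a b : R) : 1 <= rho -> 0 < b <= a ->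
  sinh (rho * b) * sinh a <= sinh (rho * a) * sinh b.
Proof.
  intros Hr Hab.
  assert (Ha := sinh_pos a ltac:(lra)). assert (Hb := sinh_pos b ltac:(lra)).
  enough (H : sinh (rho * b) / sinh b <= sinh (rho * a) / sinh a).
  { apply (Rmult_le_compat_r (sinh a * sinh b)) in H; [|nra].
    replace (sinh (rho * b) / sinh b * (sinh a * sinh b)) with (sinh (rho * b) * sinh a) in H
      by (field; lra).
    replace (sinh (rho * a) / sinh a * (sinh a * sinh b)) with (sinh (rho * a) * sinh b) in H
      by (field; lra). exact H. }
  assert (Hs : forall x, is_derive (fun x => sinh (rho * x)) x (rho * cosh (rho * x))).
  { intros x. unfold sinh, cosh. auto_derive; [auto|].
    replace (rho * - (1) * x) with (- (rho * x)) by ring. field. }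
  apply (derive_nonneg_nondecreasing (fun x => sinh (rho * x) / sinh x)
    (fun x => (rho * cosh (rho * x) * sinh x - sinh (rho * x) * cosh x) / sinh x ^ 2)); [lra| |].
  - intros z Hz. assert (H := sinh_pos z ltac:(lra)).
    apply (is_derive_div (fun x => sinh (rho * x)) sinh); [apply Hs|apply is_derive_sinh|lra].
  - intros z Hz. assert (H := sinh_pos z ltac:(lra)).
    apply Rmult_le_pos; [|left; apply Rinv_0_lt_compat; nra].
    replace 0 with (rho * cosh (rho * 0) * sinh 0 - sinh (rho * 0) * cosh 0)
      by (rewrite Rmult_0_r, sinh_0; ring).
    apply (derive_nonneg_nondecreasing
      (fun x => rho * cosh (rho * x) * sinh x - sinh (rho * x) * cosh x)
      (fun x => (rho ^ 2 - 1) * (sinh (rho * x) * sinh x))); [lra| |].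
    + intros y Hy. unfold sinh, cosh. auto_derive; [auto|].
      field.
    + intros y Hy. generalize (sinh_pos (rho * y) ltac:(nra)) (sinh_pos y ltac:(lra)).
      intros. apply Rmult_le_pos; nra.
Qed.

(** With [l = ln (cosh z)], [a = (z + l) / 2], [b = (z - l) / 2] and [rho = r - 1], the claim is a
    rewriting of [sinh (rho b) <= exp (- z) sinh (rho a)]. For [rho = 1] this is an equality, so it
    follows from the monotonicity of [sinh (rho x) / sinh x]; [r >= 2] is [rho >= 1]. *)
Lemma tanh_mul_le_one_minus_cosh_pow (z r : R) : 0 < z -> 2 <= r ->
  sinh z * sinh (r * z / 2)
    <= (1 - exp (- (r * ln (cosh z)))) * (cosh z * cosh (r * z / 2)).
Proof.
  intros Hz Hr.
  set (l := ln (cosh z)). set (rho := r - 1).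
  assert (C1 := cosh_gt_1 z Hz).
  assert (Hl : 0 < l) by (unfold l; rewrite <- ln_1; apply ln_increasing; lra).
  assert (Hlz : l < z).
  { unfold l. rewrite <- (ln_exp z) at 2. apply ln_increasing; [lra|].
    unfold cosh. assert (exp (- z) < exp z) by (apply exp_increasing; lra). lra. }
  assert (H := sinh_scale_ratio rho ((z + l) / 2) ((z - l) / 2)
    ltac:(unfold rho; lra) ltac:(lra)).
  assert (Ha := sinh_pos ((z + l) / 2) ltac:(lra)).
  (* Half exponentials turn what follows into rational expressions in [P], [Q], [X], [Y], with [EQ]
     as the only relation between them. *)
  set (P := exp (z / 2)). set (Q := exp (l / 2)).
  set (X := exp (rho * z / 2)). set (Y := exp (rho * l / 2)).
  assert (HP : 0 < P) by apply exp_pos. assert (HQ : 0 < Q) by apply exp_pos.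
  assert (HX : 0 < X) by apply exp_pos. assert (HY : 0 < Y) by apply exp_pos.
  assert (Ez : exp z = P * P) by (unfold P; rewrite <- exp_plus; f_equal; field).
  assert (El : cosh z = Q * Q).
  { unfold Q. rewrite <- exp_plus. replace (l / 2 + l / 2) with l by field.
    unfold l. rewrite exp_ln; lra. }
  assert (Ec : cosh z = (P * P + / (P * P)) / 2).
  { unfold cosh. now rewrite exp_Ropp, Ez. }
  assert (EQ : 2 * (P * P) * (Q * Q) = P * P * (P * P) + 1).
  { rewrite <- El, Ec. field. lra. }
  assert (Sa : sinh ((z + l) / 2) = (P * Q - / (P * Q)) / 2).
  { unfold sinh. rewrite exp_Ropp.
    replace (exp ((z + l) / 2)) with (P * Q); [reflexivity|].
    unfold P, Q. rewrite <- exp_plus. f_equal. field. }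
  assert (Sb : sinh ((z - l) / 2) = (P / Q - Q / P) / 2).
  { unfold sinh. rewrite exp_Ropp.
    replace (exp ((z - l) / 2)) with (P / Q); [field; lra|].
    unfold P, Q, Rdiv at 1. rewrite <- exp_Ropp, <- exp_plus. f_equal. field. }
  assert (Sra : sinh (rho * ((z + l) / 2)) = (X * Y - / (X * Y)) / 2).
  { unfold sinh. rewrite exp_Ropp.
    replace (exp (rho * ((z + l) / 2))) with (X * Y); [reflexivity|].
    unfold X, Y. rewrite <- exp_plus. f_equal. field. }
  assert (Srb : sinh (rho * ((z - l) / 2)) = (X / Y - Y / X) / 2).
  { unfold sinh. rewrite exp_Ropp.
    replace (exp (rho * ((z - l) / 2))) with (X / Y); [field; lra|].
    unfold X, Y, Rdiv at 1. rewrite <- exp_Ropp, <- exp_plus. f_equal. field. }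
  (* The equality case [rho = 1], a form of [2 exp z cosh z = exp (2 z) + 1]. *)
  assert (Eab : sinh ((z - l) / 2) = / (P * P) * sinh ((z + l) / 2)).
  { rewrite Sa, Sb.
    replace (P / Q - Q / P) with ((2 * (P * P * (P * P)) - 2 * (P * P) * (Q * Q)) / (2 * P * P * P * Q))
      by (field; lra).
    replace (/ (P * P) * ((P * Q - / (P * Q)) / 2))
      with ((2 * (P * P) * (Q * Q) - 2) / (2 * P * P * P * Q) / 2) by (field; lra).
    rewrite EQ. field. lra. }
  rewrite Eab in H.
  assert (H' : sinh (rho * ((z - l) / 2)) <= / (P * P) * sinh (rho * ((z + l) / 2))).
  { apply (Rmult_le_reg_r (sinh ((z + l) / 2))); [exact Ha|]. lra. }
  rewrite Sra, Srb in H'. clear H Sra Srb Sa Sb Eab Ha.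
  assert (Hmain : 0 <= X * X * (Y * Y) / (P * P) + Y * Y - X * X - / (P * P)).
  { apply (Rmult_le_compat_r (2 * (X * Y))) in H'; [|nra].
    replace ((X / Y - Y / X) / 2 * (2 * (X * Y))) with (X * X - Y * Y) in H' by (field; lra).
    replace (/ (P * P) * ((X * Y - / (X * Y)) / 2) * (2 * (X * Y)))
      with (X * X * (Y * Y) / (P * P) - / (P * P)) in H' by (field; lra). lra. }
  assert (Sz : sinh z = (P * P - / (P * P)) / 2).
  { unfold sinh. now rewrite exp_Ropp, Ez. }
  assert (Er : exp (r * z / 2) = X * P).
  { unfold X, P. rewrite <- exp_plus. f_equal. unfold rho. field. }
  assert (Ek : exp (- (r * l)) = / (Y * Y * cosh z)).
  { rewrite exp_Ropp. f_equal. rewrite El. unfold Y, Q. rewrite <- !exp_plus.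
    f_equal. unfold rho. field. }
  rewrite Ek. unfold sinh at 2. unfold cosh at 3. rewrite exp_Ropp, Er.
  (* The difference of the two sides is a positive multiple of the quantity in [Hmain]. *)
  enough (E : (1 - / (Y * Y * cosh z)) * (cosh z * ((X * P + / (X * P)) / 2))
     - sinh z * ((X * P - / (X * P)) / 2)
     = (X * X * (Y * Y) / (P * P) + Y * Y - X * X - / (P * P)) * (P / (2 * X * (Y * Y)))).
  { assert (0 < P / (2 * X * (Y * Y))).
    { apply Rdiv_lt_0_compat; [lra|]. repeat apply Rmult_lt_0_compat; lra. }
    nra. }
  rewrite Sz.
  replace ((1 - / (Y * Y * cosh z)) * (cosh z * ((X * P + / (X * P)) / 2)))
    with ((cosh z - / (Y * Y)) * ((X * P + / (X * P)) / 2)) by (field; lra).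
  rewrite Ec. field. lra.
Qed.

(* Its sign is that of the [w]-derivative of [geom_gap / pow_gap] at [w = 1/2]. *)
Lemma half_wronskian (alpha u : R) : alpha <> 0 ->
  let P := exp (ln (cosh (alpha * u)) / alpha) in
  let T := sinh (alpha * u) / cosh (alpha * u) / alpha in
  geom_gap_w1 (- 2 * u) (1 / 2) * pow_gap alpha (1 / 2) (- 2 * u)
  - geom_gap (1 / 2) (- 2 * u) * pow_gap_w1 alpha (- 2 * u) (1 / 2)
  = 2 * exp (- u) ^ 2 * (u * cosh u - sinh u
      - P * ((cosh u - 1) * T - (sinh u - u))).
Proof.
  intros Ha P T. set (E := exp (- u)). set (z := alpha * u).
  assert (HE : 0 < E) by apply exp_pos.
  assert (Hz : 0 < exp (- z)) by apply exp_pos.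
  assert (Hc := cosh_pos z).
  assert (Es : exp (- 2 * u) = E * E) by (unfold E; rewrite <- exp_plus; f_equal; ring).
  assert (EX : exp (alpha * (- 2 * u)) = exp (- z) * exp (- z)).
  { rewrite <- exp_plus. f_equal. unfold z. ring. }
  assert (Eg : exp (1 / 2 * (- 2 * u)) = E) by (unfold E; f_equal; field).
  assert (Ei : exp u = / E) by (unfold E; rewrite exp_Ropp, Rinv_inv; reflexivity).
  assert (Ezi : exp z = / exp (- z)) by (rewrite exp_Ropp, Rinv_inv; reflexivity).
  assert (Eb : pow_base alpha (1 / 2) (- 2 * u) = exp (- z) * cosh z).
  { unfold pow_base, cosh. rewrite EX, Ezi. field. lra. }
  assert (Ep : pow_factor alpha (1 / 2) (- 2 * u) 0 = E * P).
  { unfold pow_factor. rewrite Eb, ln_mult, ln_exp by assumption.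
    unfold E, P. rewrite <- exp_plus. f_equal. unfold z. field. exact Ha. }
  assert (Ep1 : pow_factor alpha (1 / 2) (- 2 * u) 1 = E * P / (exp (- z) * cosh z)).
  { replace 1 with (0 + 1) at 2 by ring.
    rewrite pow_factor_succ by lra. now rewrite Ep, Eb. }
  unfold geom_gap_w1, pow_gap_w1, pow_gap, geom_gap, arith_mean.
  rewrite pow_factor_0, Ep, Ep1, Eg, EX, Es. unfold T. fold z.
  replace (cosh u) with ((E + / E) / 2) by (unfold cosh; fold E; rewrite Ei; field; lra).
  replace (sinh u) with ((/ E - E) / 2) by (unfold sinh; fold E; rewrite Ei; field; lra).
  replace (sinh z) with ((/ exp (- z) - exp (- z)) / 2)
    by (unfold sinh; rewrite Ezi; field; lra).
  field. repeat split; lra.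
Qed.

(** For [alpha < 0] crude bounds suffice: [P < 1], and [T < u] because [tanh z < z]. *)
Lemma half_wronskian_pos (alpha u : R) : alpha < 0 -> 0 < u ->
  0 < geom_gap_w1 (- 2 * u) (1 / 2) * pow_gap alpha (1 / 2) (- 2 * u)
  - geom_gap (1 / 2) (- 2 * u) * pow_gap_w1 alpha (- 2 * u) (1 / 2).
Proof.
  intros Ha Hu. rewrite half_wronskian by lra. cbv zeta.
  assert (HK := sinh_lt_id_cosh u Hu). assert (HC := cosh_gt_1 u Hu).
  set (z := - alpha * u). assert (Hz : 0 < z) by (unfold z; nra).
  assert (Tz := sinh_lt_id_cosh z Hz). assert (Cz := cosh_gt_1 z Hz).
  replace (alpha * u) with (- z) by (unfold z; ring).
  replace (cosh (- z)) with (cosh z) by (unfold cosh; rewrite Ropp_involutive; field).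
  replace (sinh (- z)) with (- sinh z) by (unfold sinh; rewrite Ropp_involutive; field).
  set (P := exp (ln (cosh z) / alpha)).
  assert (HP : 0 < P < 1).
  { split; [apply exp_pos|]. rewrite <- exp_0. apply exp_increasing.
    assert (0 < ln (cosh z)) by (rewrite <- ln_1; apply ln_increasing; lra).
    assert (/ alpha < 0) by (apply Rinv_lt_0_compat; lra). unfold Rdiv. nra. }
  set (T := - sinh z / cosh z / alpha).
  assert (HT : T < u).
  { replace T with (sinh z / (cosh z * - alpha)) by (unfold T; field; lra).
    apply (proj2 (Rlt_div_l _ _ (cosh z * - alpha) ltac:(nra))).
    replace (u * (cosh z * - alpha)) with (z * cosh z) by (unfold z; ring). exact Tz. }
  assert (Hb : (cosh u - 1) * T - (sinh u - u) < u * cosh u - sinh u) by nra.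
  assert (0 < 2 * exp (- u) ^ 2) by (generalize (exp_pos (- u)); nra).
  apply Rmult_lt_0_compat; [assumption|].
  set (b := (cosh u - 1) * T - (sinh u - u)) in *.
  destruct (Rle_or_lt b 0); nra.
Qed.

(** With [K = u cosh u - sinh u] the claim is [(cosh u - 1) (u - T) <= (1 - 1 / P) K]. It comes from
    multiplying [I1] and [I2] and cancelling [tanh z] and [sinh u]. [I1] is the bound on
    [tanh z tanh (r z / 2)] for [r = 1 / alpha]; [I2] is the growth of the Langevin function from
    [z = alpha u] to [u]. *)
Lemma half_wronskian_nonpos (alpha u : R) : 0 < alpha <= 1 / 2 -> 0 < u ->
  geom_gap_w1 (- 2 * u) (1 / 2) * pow_gap alpha (1 / 2) (- 2 * u)
  - geom_gap (1 / 2) (- 2 * u) * pow_gap_w1 alpha (- 2 * u) (1 / 2) <= 0.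
Proof.
  intros Ha Hu. rewrite half_wronskian by lra. cbv zeta.
  assert (HK := sinh_lt_id_cosh u Hu). assert (HC := cosh_gt_1 u Hu).
  assert (HS := sinh_pos u Hu).
  set (z := alpha * u). assert (Hz : 0 < z <= u) by (unfold z; nra).
  assert (Sz := sinh_pos z ltac:(lra)). assert (Cz := cosh_pos z).
  assert (Hr : 2 <= 1 / alpha).
  { apply (proj1 (Rle_div_r _ _ _ (proj1 Ha))). lra. }
  assert (H1 := tanh_mul_le_one_minus_cosh_pow z (1 / alpha) ltac:(lra) Hr).
  assert (H2 := langevin_nondecreasing z u Hz).
  set (P := exp (ln (cosh z) / alpha)).
  assert (HP : 0 < P) by apply exp_pos.
  replace (exp (- (1 / alpha * ln (cosh z)))) with (/ P) in H1
    by (unfold P; rewrite <- exp_Ropp; f_equal; field; lra).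
  replace (1 / alpha * z / 2) with (u / 2) in H1 by (unfold z; field; lra).
  set (th := sinh z / cosh z).
  assert (Hth : 0 < th) by (unfold th; apply Rdiv_lt_0_compat; lra).
  assert (Eth : cosh z / sinh z = / th) by (unfold th; field; lra).
  assert (Sh := sinh_pos (u / 2) ltac:(lra)). assert (Ch := cosh_pos (u / 2)).
  assert (Eu : exp u = exp (u / 2) * exp (u / 2)) by (rewrite <- exp_plus; f_equal; field).
  assert (Pe := exp_pos (u / 2)).
  (* Half-angle formulas: [(cosh u - 1) / sinh u = tanh (u / 2)], and [r z / 2 = u / 2]. *)
  assert (EC : cosh u - 1 = 2 * (sinh (u / 2) * sinh (u / 2))).
  { unfold cosh, sinh. rewrite !exp_Ropp, Eu. field. lra. }
  assert (ES : sinh u = 2 * (sinh (u / 2) * cosh (u / 2))).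
  { unfold cosh, sinh. rewrite !exp_Ropp, Eu. field. lra. }
  assert (I1 : th * (cosh u - 1) <= (1 - / P) * sinh u).
  { rewrite EC, ES.
    apply (Rmult_le_reg_r (cosh z)); [exact Cz|].
    replace (th * (2 * (sinh (u / 2) * sinh (u / 2))) * cosh z)
      with (2 * sinh (u / 2) * (sinh z * sinh (u / 2))) by (unfold th; field; lra).
    replace ((1 - / P) * (2 * (sinh (u / 2) * cosh (u / 2))) * cosh z)
      with (2 * sinh (u / 2) * ((1 - / P) * (cosh z * cosh (u / 2)))) by ring.
    apply Rmult_le_compat_l; [lra|exact H1]. }
  set (T := th / alpha).
  set (K := u * cosh u - sinh u). assert (PK : 0 < K) by (unfold K; lra).
  assert (I2 : sinh u * (u - T) <= th * K).
  { enough (E : th * K - sinh u * (u - T)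
      = u * sinh u * th * (cosh u / sinh u - 1 / u - (cosh z / sinh z - 1 / z))).
    { assert (0 <= th * K - sinh u * (u - T)); [|lra]. rewrite E.
      apply Rmult_le_pos; [|lra].
      left. apply Rmult_lt_0_compat; [now apply Rmult_lt_0_compat|assumption]. }
    rewrite Eth. unfold K, T, z. field. repeat split; lra. }
  assert (I3 : (cosh u - 1) * (u - T) <= (1 - / P) * K).
  { apply (Rmult_le_reg_r (sinh u)); [exact HS|].
    apply Rle_trans with ((cosh u - 1) * (th * K)); [nra|].
    replace ((1 - / P) * K * sinh u) with (K * ((1 - / P) * sinh u)) by ring.
    nra. }
  assert (I4 : P * ((cosh u - 1) * (u - T)) <= P * K - K).
  { replace (P * K - K) with (P * ((1 - / P) * K)) by (field; lra).
    apply Rmult_le_compat_l; lra. }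
  assert (0 < 2 * exp (- u) ^ 2) by (generalize (exp_pos (- u)); nra).
  enough (K - P * ((cosh u - 1) * T - (sinh u - u)) <= 0) by nra.
  replace ((cosh u - 1) * T - (sinh u - u)) with (K - (cosh u - 1) * (u - T))
    by (unfold K; ring). lra.
Qed.

(** * Monotonicity in the weight *)

(* [D = c V - U] vanishes at [0] and [w1]; if it were nonpositive at [w2], its second
   derivative would pass from nonpositive to nonnegative, which [pattern] excludes. *)
Lemma ratio_decreasing (U U1 U2 V V1 V2 : R -> R) (b w1 w2 : R) :
  0 < w1 -> w1 < w2 -> w2 < b ->
  (forall y, 0 <= y <= b -> is_derive U y (U1 y)) ->
  (forall y, 0 <= y <= b -> is_derive U1 y (U2 y)) ->
  (forall y, 0 <= y <= b -> is_derive V y (V1 y)) ->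
  (forall y, 0 <= y <= b -> is_derive V1 y (V2 y)) ->
  U 0 = 0 -> V 0 = 0 -> 0 < V w1 -> 0 < V w2 ->
  U b <= U w1 / V w1 * V b ->
  (forall y z, 0 < y < z -> z < b ->
     U w1 / V w1 * V2 y <= U2 y -> U2 z <= U w1 / V w1 * V2 z -> False) ->
  U w2 / V w2 < U w1 / V w1.
Proof.
  intros H0 H12 H2b HU HU1 HV HV1 EU EV P1 P2 Hb pattern.
  set (c := U w1 / V w1) in *.
  assert (Ec : U w1 = c * V w1) by (unfold c; field; lra).
  apply (proj2 (Rlt_div_l _ _ _ P2)).
  destruct (Rlt_or_le (U w2) (c * V w2)) as [|Hle]; [assumption|exfalso].
  destruct (second_derivative_sign_change (fun w => c * V w - U w)
    (fun w => c * V1 w - U1 w) (fun w => c * V2 w - U2 w) 0 w1 w2 b)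
    as [y [z [Hy [Hz [Sy Sz]]]]]; try lra.
  - intros y Hy. apply (is_derive_minus (fun w => c * V w) U); [|now apply HU].
    apply (is_derive_scal V). now apply HV.
  - intros y Hy. apply (is_derive_minus (fun w => c * V1 w) U1); [|now apply HU1].
    apply (is_derive_scal V1). now apply HV1.
  - rewrite EU, EV. lra.
  - apply (pattern y z); lra.
Qed.

(* Logarithm, up to a constant, of [geom_gap_w2 / pow_gap_w2]. *)
Definition log_ratio (alpha t w : R) : R :=
  w * t + (2 - 1 / alpha) * ln (pow_base alpha w t).

Lemma exp_log_ratio (alpha t w : R) :
  exp (log_ratio alpha t w) * pow_factor alpha w t 2 = exp (w * t).
Proof.
  unfold log_ratio, pow_factor. rewrite <- exp_plus. f_equal. ring.
Qed.

(** Dividing by the positive power of [pow_base] leaves one function of [w] compared with a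
    constant, so the shape of [log_ratio] governs the possible sign changes. *)
Lemma second_derivative_le_iff (alpha t w K : R) :
  (t ^ 2 * exp (w * t) <= K * pow_factor alpha w t 2
     <-> t ^ 2 * exp (log_ratio alpha t w) <= K) /\
  (K * pow_factor alpha w t 2 <= t ^ 2 * exp (w * t)
     <-> K <= t ^ 2 * exp (log_ratio alpha t w)).
Proof.
  rewrite <- (exp_log_ratio alpha t w), <- Rmult_assoc.
  assert (H := pow_factor_pos alpha w t 2).
  split; split; intros Hle; try (apply (Rmult_le_reg_r (pow_factor alpha w t 2)); assumption);
    apply Rmult_le_compat_r; lra.
Qed.

Lemma is_derive_log_ratio (alpha t w : R) : 0 <= w <= 1 ->
  is_derive (log_ratio alpha t) w
    (t + (2 - 1 / alpha) * ((exp (alpha * t) - 1) / pow_base alpha w t)).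
Proof.
  intros Hw. assert (H := pow_base_pos alpha w t Hw).
  unfold log_ratio, pow_base in *. auto_derive; [exact H|].
  replace (1 + - w) with (1 - w) by ring. unfold Rdiv. ring.
Qed.

(** Here [2 - 1 / alpha > 0], and both summands decrease in [w]. *)
Lemma log_ratio_decreasing (alpha t y z : R) : 1 / 2 < alpha -> t < 0 ->
  0 <= y < z -> z <= 1 -> log_ratio alpha t z < log_ratio alpha t y.
Proof.
  intros Ha Ht Hy Hz.
  assert (HX : exp (alpha * t) < 1).
  { rewrite <- exp_0. apply exp_increasing. nra. }
  assert (Hr : 1 / alpha < 2).
  { apply (proj2 (Rlt_div_l _ _ alpha ltac:(lra))). lra. }
  assert (HL : ln (pow_base alpha z t) <= ln (pow_base alpha y t)).
  { apply ln_le; [apply pow_base_pos; lra|]. unfold pow_base. nra. }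
  unfold log_ratio. nra.
Qed.

(** Now [2 - 1 / alpha < 0] and the logarithmic term increases, but for [w <= 1 / 2] its slope stays
    below [- t (1 - 2 alpha)], which the slope [t] of the other term outweighs. *)
Lemma log_ratio_decreasing_half (alpha t y z : R) : 0 < alpha < 1 / 2 -> t < 0 ->
  0 <= y < z -> z <= 1 / 2 -> log_ratio alpha t z < log_ratio alpha t y.
Proof.
  intros Ha Ht Hy Hz.
  enough (- log_ratio alpha t y < - log_ratio alpha t z) by lra.
  apply (derive_pos_increasing (fun w => - log_ratio alpha t w)
    (fun w => - (t + (2 - 1 / alpha) * ((exp (alpha * t) - 1) / pow_base alpha w t)))); [lra| |].
  { intros w Hw. apply (is_derive_opp (log_ratio alpha t)), is_derive_log_ratio. lra. }
  intros w Hw.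
  assert (HX : exp (alpha * t) < 1).
  { rewrite <- exp_0. apply exp_increasing. nra. }
  assert (PX := exp_pos (alpha * t)).
  assert (HL := pow_base_pos alpha w t ltac:(lra)).
  assert (HL2 : (1 + exp (alpha * t)) / 2 <= pow_base alpha w t) by (unfold pow_base; nra).
  set (v := - (alpha * t) / 2). assert (Hv : 0 < v) by (unfold v; nra).
  assert (Tv := sinh_lt_id_cosh v Hv). assert (Cv := cosh_pos v).
  (* (1 - e^{-2v}) / L <= 2 tanh v < 2 v *)
  assert (E1 : (1 - exp (alpha * t)) = 2 * exp (- v) * sinh v).
  { replace (alpha * t) with (- v + - v) by (unfold v; field).
    unfold sinh. rewrite exp_plus, !exp_Ropp. generalize (exp_pos v). intros. field. lra. }
  assert (E2 : (1 + exp (alpha * t)) / 2 = exp (- v) * cosh v).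
  { replace (alpha * t) with (- v + - v) by (unfold v; field).
    unfold cosh. rewrite exp_plus, !exp_Ropp. generalize (exp_pos v). intros. field. lra. }
  assert (Pv := exp_pos (- v)).
  assert (I : (1 - exp (alpha * t)) / pow_base alpha w t < 2 * v).
  { apply (proj2 (Rlt_div_l _ _ _ HL)).
    apply Rlt_le_trans with (2 * v * (exp (- v) * cosh v)); [rewrite E1; nra|].
    rewrite <- E2. nra. }
  set (q := (1 - exp (alpha * t)) / pow_base alpha w t) in *.
  replace ((exp (alpha * t) - 1) / pow_base alpha w t) with (- q) by (unfold q; field; lra).
  assert (Hr : 0 < 1 / alpha - 2).
  { enough (2 < 1 / alpha) by lra. apply (proj1 (Rlt_div_r _ _ alpha ltac:(lra))). lra. }
  assert (J : (1 / alpha - 2) * q < (1 / alpha - 2) * (2 * v)) by nra.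
  replace ((1 / alpha - 2) * (2 * v)) with (- t * (1 - 2 * alpha)) in J
    by (unfold v; field; lra). nra.
Qed.

(** For [alpha < 0] the slope of [log_ratio] is [t] plus a positive multiple of [/ pow_base], and
    [pow_base] increases in [w]. The slope is thus strictly decreasing, which excludes a dip. *)
Lemma log_ratio_quasiconcave (alpha t x y z : R) : alpha < 0 -> t < 0 ->
  0 <= x < y -> y < z -> z <= 1 ->
  log_ratio alpha t y <= log_ratio alpha t x ->
  log_ratio alpha t y <= log_ratio alpha t z -> False.
Proof.
  intros Ha Ht Hx Hy Hz H1 H2.
  destruct (mean_value_nonpos (log_ratio alpha t)
    (fun w => t + (2 - 1 / alpha) * ((exp (alpha * t) - 1) / pow_base alpha w t)) x y)
    as [c [Ic Sc]]; [lra|intros; apply is_derive_log_ratio; lra|lra|].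
  destruct (mean_value_nonneg (log_ratio alpha t)
    (fun w => t + (2 - 1 / alpha) * ((exp (alpha * t) - 1) / pow_base alpha w t)) y z)
    as [d [Id Sd]]; [lra|intros; apply is_derive_log_ratio; lra|lra|].
  assert (HX : 1 < exp (alpha * t)).
  { rewrite <- exp_0. apply exp_increasing. nra. }
  assert (Hr : 1 / alpha < 0).
  { unfold Rdiv. rewrite Rmult_1_l. now apply Rinv_lt_0_compat. }
  assert (HL : / pow_base alpha d t < / pow_base alpha c t).
  { assert (Pc := pow_base_pos alpha c t ltac:(lra)).
    apply Rinv_lt_contravar; [apply Rmult_lt_0_compat; apply pow_base_pos; lra|].
    unfold pow_base. nra. }
  unfold Rdiv in Sc, Sd. rewrite <- !Rmult_assoc in Sc, Sd.
  assert (0 < (2 - 1 * / alpha) * (exp (alpha * t) - 1)) by (unfold Rdiv in Hr; nra).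
  nra.
Qed.

(** With [b = 1] the end condition of [ratio_decreasing] reads [0 <= 0], and the decrease of
    [log_ratio] forbids the sign pattern. The power gap is negated to make it positive. *)
Lemma gap_ratio_decreasing_above_one (alpha t w1 w2 : R) : 1 < alpha -> t < 0 ->
  0 < w1 -> w1 < w2 -> w2 < 1 ->
  geom_gap w2 t / - pow_gap alpha w2 t < geom_gap w1 t / - pow_gap alpha w1 t.
Proof.
  intros Ha Ht H1 H12 H2.
  apply (ratio_decreasing (fun w => geom_gap w t) (geom_gap_w1 t) (geom_gap_w2 t)
    (fun w => - pow_gap alpha w t) (fun w => - pow_gap_w1 alpha t w)
    (fun w => - pow_gap_w2 alpha t w) 1); try assumption.
  - intros; apply is_derive_geom_gap_w.
  - intros; apply is_derive_geom_gap_w.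
  - intros; apply (is_derive_opp (fun w => pow_gap alpha w t)), is_derive_pow_gap_w; lra.
  - intros; apply (is_derive_opp (pow_gap_w1 alpha t)), is_derive_pow_gap_w; lra.
  - apply geom_gap_0.
  - rewrite pow_gap_0; ring.
  - generalize (pow_gap_neg alpha w1 t). lra.
  - generalize (pow_gap_neg alpha w2 t). lra.
  - rewrite geom_gap_1, pow_gap_1; lra.
  - cbv beta. intros y z Hy Hz Sy Sz. set (c := geom_gap w1 t / - pow_gap alpha w1 t) in *.
    set (K := c * ((alpha - 1) * ((exp (alpha * t) - 1) / alpha) ^ 2)).
    assert (Iy := proj1 (proj1 (second_derivative_le_iff alpha t y K))).
    assert (Iz := proj1 (proj2 (second_derivative_le_iff alpha t z K))).
    unfold geom_gap_w2, pow_gap_w2 in Sy, Sz.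
    specialize (Iy ltac:(unfold K; lra)). specialize (Iz ltac:(unfold K; lra)).
    assert (M := exp_increasing _ _ (log_ratio_decreasing alpha t y z ltac:(lra) Ht
      ltac:(lra) ltac:(lra))).
    assert (0 < t ^ 2) by nra. nra.
Qed.

(** The hypotheses put the constant [K] above [t ^ 2 * exp log_ratio] at [y] and below it at [z],
    against the decrease of [log_ratio]. *)
Lemma gap_ratio_pattern (alpha t c y z : R) :
  log_ratio alpha t z < log_ratio alpha t y -> t < 0 ->
  c * pow_gap_w2 alpha t y <= geom_gap_w2 t y ->
  geom_gap_w2 t z <= c * pow_gap_w2 alpha t z -> False.
Proof.
  intros M Ht Sy Sz.
  set (K := c * ((1 - alpha) * ((exp (alpha * t) - 1) / alpha) ^ 2)).
  assert (Iy := proj1 (proj1 (second_derivative_le_iff alpha t y K))).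
  assert (Iz := proj1 (proj2 (second_derivative_le_iff alpha t z K))).
  unfold geom_gap_w2, pow_gap_w2 in Sy, Sz.
  specialize (Iy ltac:(unfold K; lra)). specialize (Iz ltac:(unfold K; lra)).
  apply exp_increasing in M. assert (0 < t ^ 2) by nra. nra.
Qed.

Lemma gap_ratio_decreasing_middle (alpha t w1 w2 : R) : 1 / 2 < alpha < 1 -> t < 0 ->
  0 < w1 -> w1 < w2 -> w2 < 1 ->
  geom_gap w2 t / pow_gap alpha w2 t < geom_gap w1 t / pow_gap alpha w1 t.
Proof.
  intros Ha Ht H1 H12 H2.
  apply (ratio_decreasing (fun w => geom_gap w t) (geom_gap_w1 t) (geom_gap_w2 t)
    (fun w => pow_gap alpha w t) (pow_gap_w1 alpha t) (pow_gap_w2 alpha t) 1);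
    try assumption; try (apply pow_gap_pos; lra);
    try (intros; apply is_derive_geom_gap_w); try (intros; apply is_derive_pow_gap_w; lra).
  - apply geom_gap_0.
  - apply pow_gap_0.
  - rewrite geom_gap_1, pow_gap_1; lra.
  - cbv beta. intros y z Hy Hz. apply gap_ratio_pattern; [|exact Ht].
    apply log_ratio_decreasing; lra.
Qed.

(** [log_ratio] is controlled only up to [1 / 2], where the gaps do not vanish. The derivative there
    first shows that the ratio at [w1] is at least its value [c0] at [1 / 2]; this is the end
    condition of [ratio_decreasing] with [b = 1 / 2]. *)
Lemma gap_ratio_decreasing_low (alpha t w1 w2 : R) : 0 < alpha < 1 / 2 -> t < 0 ->
  0 < w1 -> w1 < w2 -> w2 < 1 / 2 ->
  geom_gap w2 t / pow_gap alpha w2 t < geom_gap w1 t / pow_gap alpha w1 t.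
Proof.
  intros Ha Ht H1 H12 H2.
  set (c0 := geom_gap (1 / 2) t / pow_gap alpha (1 / 2) t).
  assert (Ph := pow_gap_pos alpha (1 / 2) t ltac:(lra) ltac:(lra) ltac:(lra) ltac:(lra)).
  assert (P1 := pow_gap_pos alpha w1 t ltac:(lra) ltac:(lra) ltac:(lra) ltac:(lra)).
  assert (Ec0 : geom_gap (1 / 2) t = c0 * pow_gap alpha (1 / 2) t)
    by (unfold c0; field; lra).
  assert (W := half_wronskian_nonpos alpha (- t / 2) ltac:(lra) ltac:(lra)).
  replace (- 2 * (- t / 2)) with t in W by field.
  assert (Hc : c0 * pow_gap alpha w1 t <= geom_gap w1 t).
  { destruct (Rle_or_lt (c0 * pow_gap alpha w1 t) (geom_gap w1 t)) as [|Hlt];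
      [assumption|exfalso].
    destruct (second_derivative_sign_change_slope
      (fun w => c0 * pow_gap alpha w t - geom_gap w t)
      (fun w => c0 * pow_gap_w1 alpha t w - geom_gap_w1 t w)
      (fun w => c0 * pow_gap_w2 alpha t w - geom_gap_w2 t w) 0 w1 (1 / 2))
      as [y [z [Hy [Hz [Sy Sz]]]]]; try lra.
    - intros y Hy. apply (is_derive_minus (fun w => c0 * pow_gap alpha w t)).
      + apply (is_derive_scal (fun w => pow_gap alpha w t)), is_derive_pow_gap_w; lra.
      + apply is_derive_geom_gap_w.
    - intros y Hy. apply (is_derive_minus (fun w => c0 * pow_gap_w1 alpha t w)).
      + apply (is_derive_scal (pow_gap_w1 alpha t)), is_derive_pow_gap_w; lra.
      + apply is_derive_geom_gap_w.
    - rewrite geom_gap_0, pow_gap_0. lra.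
    (* [W] says that [c0 * pow_gap - geom_gap] has nonnegative slope at [1 / 2]. *)
    - rewrite Ec0 in W. nra.
    - apply (gap_ratio_pattern alpha t c0 y z); try lra.
      apply log_ratio_decreasing_half; lra. }
  apply (ratio_decreasing (fun w => geom_gap w t) (geom_gap_w1 t) (geom_gap_w2 t)
    (fun w => pow_gap alpha w t) (pow_gap_w1 alpha t) (pow_gap_w2 alpha t) (1 / 2));
    try assumption; try (apply pow_gap_pos; lra);
    try (intros; apply is_derive_geom_gap_w); try (intros; apply is_derive_pow_gap_w; lra).
  - apply geom_gap_0.
  - apply pow_gap_0.
  - rewrite Ec0. apply Rmult_le_compat_r; [lra|].
    apply (proj1 (Rle_div_r _ _ _ P1)). exact Hc.
  - cbv beta. intros y z Hy Hz. apply gap_ratio_pattern; [|exact Ht].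
    apply log_ratio_decreasing_half; lra.
Qed.

(** A third point [x] with the same sign as [y] makes [z] a dip of [log_ratio]. *)
Lemma gap_ratio_pattern_neg (alpha t c y z x : R) : alpha < 0 -> t < 0 -> 0 < c ->
  0 < y < z -> z < x -> x < 1 ->
  c * geom_gap_w2 t y <= pow_gap_w2 alpha t y ->
  pow_gap_w2 alpha t z <= c * geom_gap_w2 t z ->
  c * geom_gap_w2 t x <= pow_gap_w2 alpha t x -> False.
Proof.
  intros Ha Ht Hc Hy Hz Hx Sy Sz Sx.
  set (K := (1 - alpha) * ((exp (alpha * t) - 1) / alpha) ^ 2 / c).
  assert (EK : c * K = (1 - alpha) * ((exp (alpha * t) - 1) / alpha) ^ 2)
    by (unfold K; field; lra).
  unfold geom_gap_w2, pow_gap_w2 in Sy, Sz, Sx. rewrite <- EK in Sy, Sz, Sx.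
  assert (Iy := proj1 (proj2 (second_derivative_le_iff alpha t y K)) ltac:(nra)).
  assert (Iz := proj1 (proj1 (second_derivative_le_iff alpha t z K)) ltac:(nra)).
  assert (Ix := proj1 (proj2 (second_derivative_le_iff alpha t x K)) ltac:(nra)).
  assert (Pt : 0 < t ^ 2) by nra.
  assert (mono : forall a b, t ^ 2 * exp a <= t ^ 2 * exp b -> a <= b).
  { intros a b Hab. destruct (Rle_or_lt a b) as [|Hlt]; [assumption|].
    apply exp_increasing in Hlt. nra. }
  apply (log_ratio_quasiconcave alpha t y z x); try lra; apply mono; lra.
Qed.

(** The reciprocal ratio is shown to decrease. The function [c0 * geom_gap - pow_gap] vanishes at
    [0], [1 / 2] and [1], and its strictly positive slope at [1 / 2] yields the third point [x]
    required by the concave shape of [log_ratio]. *)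
Lemma gap_ratio_increasing_neg (alpha t w1 w2 : R) : alpha < 0 -> t < 0 ->
  0 < w1 -> w1 < w2 -> w2 < 1 / 2 ->
  geom_gap w1 t / pow_gap alpha w1 t < geom_gap w2 t / pow_gap alpha w2 t.
Proof.
  intros Ha Ht H1 H12 H2.
  assert (PB : forall w, 0 < w < 1 -> 0 < pow_gap alpha w t)
    by (intros; apply pow_gap_pos; lra).
  assert (PA : forall w, 0 < w < 1 -> 0 < geom_gap w t)
    by (intros; apply geom_gap_pos; lra).
  enough (HR : pow_gap alpha w2 t / geom_gap w2 t < pow_gap alpha w1 t / geom_gap w1 t).
  { assert (A1 := PA w1 ltac:(lra)). assert (A2 := PA w2 ltac:(lra)).
    assert (B1 := PB w1 ltac:(lra)). assert (B2 := PB w2 ltac:(lra)).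
    replace (geom_gap w1 t / pow_gap alpha w1 t) with (/ (pow_gap alpha w1 t / geom_gap w1 t))
      by (field; lra).
    replace (geom_gap w2 t / pow_gap alpha w2 t) with (/ (pow_gap alpha w2 t / geom_gap w2 t))
      by (field; lra).
    apply Rinv_lt_contravar; [|exact HR].
    apply Rmult_lt_0_compat; apply Rdiv_lt_0_compat; assumption. }
  set (c0 := pow_gap alpha (1 / 2) t / geom_gap (1 / 2) t).
  assert (Ph := PB (1 / 2) ltac:(lra)). assert (Gh := PA (1 / 2) ltac:(lra)).
  assert (Hc0 : 0 < c0) by (unfold c0; now apply Rdiv_lt_0_compat).
  assert (Ec0 : pow_gap alpha (1 / 2) t = c0 * geom_gap (1 / 2) t)
    by (unfold c0; field; lra).
  assert (W := half_wronskian_pos alpha (- t / 2) ltac:(lra) ltac:(lra)).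
  replace (- 2 * (- t / 2)) with t in W by field.
  assert (DD : forall y, 0 <= y <= 1 -> is_derive
    (fun w => c0 * geom_gap w t - pow_gap alpha w t) y
    (c0 * geom_gap_w1 t y - pow_gap_w1 alpha t y)).
  { intros y Hy. apply (is_derive_minus (fun w => c0 * geom_gap w t)).
    + apply (is_derive_scal (fun w => geom_gap w t)), is_derive_geom_gap_w.
    + apply is_derive_pow_gap_w; lra. }
  assert (DD1 : forall y, 0 <= y <= 1 -> is_derive
    (fun w => c0 * geom_gap_w1 t w - pow_gap_w1 alpha t w) y
    (c0 * geom_gap_w2 t y - pow_gap_w2 alpha t y)).
  { intros y Hy. apply (is_derive_minus (fun w => c0 * geom_gap_w1 t w)).
    + apply (is_derive_scal (geom_gap_w1 t)), is_derive_geom_gap_w.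
    + apply is_derive_pow_gap_w; lra. }
  assert (S0 : 0 < c0 * geom_gap_w1 t (1 / 2) - pow_gap_w1 alpha t (1 / 2))
    by (rewrite Ec0 in W; nra).
  (* Past [1 / 2] the function starts upward and returns to [0] at [1], so its slope must fall
     somewhere. *)
  assert (Hx : exists x, 1 / 2 < x < 1 /\ c0 * geom_gap_w2 t x <= pow_gap_w2 alpha t x).
  { destruct (mean_value_nonpos (fun w => c0 * geom_gap w t - pow_gap alpha w t)
      (fun w => c0 * geom_gap_w1 t w - pow_gap_w1 alpha t w) (1 / 2) 1) as [d [Id Sd]].
    - lra.
    - intros; apply DD; lra.
    - rewrite geom_gap_1, pow_gap_1 by lra. lra.
    - destruct (mean_value_nonpos (fun w => c0 * geom_gap_w1 t w - pow_gap_w1 alpha t w)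
        (fun w => c0 * geom_gap_w2 t w - pow_gap_w2 alpha t w) (1 / 2) d) as [e [Ie Se]].
      + lra.
      + intros; apply DD1; lra.
      + lra.
      + exists e. lra. }
  destruct Hx as [x [Ix Sx]].
  assert (A1 := PA w1 ltac:(lra)). assert (B1 := PB w1 ltac:(lra)).
  set (c1 := pow_gap alpha w1 t / geom_gap w1 t).
  assert (Ec1 : pow_gap alpha w1 t = c1 * geom_gap w1 t) by (unfold c1; field; lra).
  assert (Hc : c0 <= c1).
  { destruct (Rle_or_lt c0 c1) as [|Hlt]; [assumption|exfalso].
    destruct (second_derivative_sign_change_slope
      (fun w => c0 * geom_gap w t - pow_gap alpha w t)
      (fun w => c0 * geom_gap_w1 t w - pow_gap_w1 alpha t w)
      (fun w => c0 * geom_gap_w2 t w - pow_gap_w2 alpha t w) 0 w1 (1 / 2))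
      as [y [z [Hy [Hz [Sy Sz]]]]]; try lra.
    - intros; apply DD; lra.
    - intros; apply DD1; lra.
    - rewrite geom_gap_0, pow_gap_0. nra.
    - nra.
    - apply (gap_ratio_pattern_neg alpha t c0 y z x); lra. }
  apply (ratio_decreasing (fun w => pow_gap alpha w t) (pow_gap_w1 alpha t)
    (pow_gap_w2 alpha t) (fun w => geom_gap w t) (geom_gap_w1 t) (geom_gap_w2 t) (1 / 2));
    try assumption; try (apply PA; lra);
    try (intros; apply is_derive_geom_gap_w); try (intros; apply is_derive_pow_gap_w; lra).
  - apply pow_gap_0.
  - apply geom_gap_0.
  - fold c1. rewrite Ec0. apply Rmult_le_compat_r; lra.
  - cbv beta. fold c1. intros y z Hy Hz Sy Sz.
    apply (gap_ratio_pattern_neg alpha t c1 y z x); try lra.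
    (* The point [x] found for [c0] also serves [c1 >= c0], because [geom_gap] is concave in [w]. *)
    assert (geom_gap_w2 t x <= 0).
    { unfold geom_gap_w2. generalize (exp_pos (x * t)). nra. }
    nra.
Qed.

(** * Existence of the extrema *)

Lemma pow_base_at_0 (alpha w : R) : pow_base alpha w 0 = 1.
Proof. unfold pow_base. rewrite Rmult_0_r, exp_0. ring. Qed.

Lemma pow_factor_at_0 (alpha w j : R) : pow_factor alpha w 0 j = 1.
Proof. unfold pow_factor. now rewrite pow_base_at_0, ln_1, Rmult_0_l, exp_0. Qed.

Lemma geom_gap_jet_0 (w : R) :
  geom_gap w 0 = 0 /\ geom_gap_t1 w 0 = 0 /\
  geom_gap_t2 w 0 = w * (1 - w) /\ geom_gap_t3 w 0 = w * (1 - w ^ 2).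
Proof.
  unfold geom_gap, arith_mean, geom_gap_t1, geom_gap_t2, geom_gap_t3.
  rewrite Rmult_0_r, exp_0. repeat split; ring.
Qed.

(** The quotient of the second derivatives at [0] does not depend on [w]; the third derivatives are
    the first to distinguish the weights. *)
Lemma pow_gap_jet_0 (alpha w : R) :
  pow_gap alpha w 0 = 0 /\ pow_gap_t1 alpha w 0 = 0 /\
  pow_gap_t2 alpha w 0 = (1 - alpha) * (w * (1 - w)) /\
  pow_gap_t3 alpha w 0
    = (1 - alpha) * (w * (1 + alpha - 3 * alpha * w - (1 - 2 * alpha) * w ^ 2)).
Proof.
  unfold pow_gap, arith_mean, pow_gap_t1, pow_gap_t2, pow_gap_t3.
  rewrite pow_factor_0, !pow_factor_at_0, Rmult_0_r, exp_0. repeat split; ring.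
Qed.

Lemma continuous_geom_gap_t3 (w t : R) : continuous (geom_gap_t3 w) t.
Proof.
  apply (ex_derive_continuous (geom_gap_t3 w)). unfold geom_gap_t3. auto_derive. auto.
Qed.

Lemma continuous_pow_gap_t3 (alpha w t : R) : 0 <= w <= 1 -> alpha <> 0 ->
  continuous (pow_gap_t3 alpha w) t.
Proof.
  intros Hw Ha. apply (ex_derive_continuous (pow_gap_t3 alpha w)).
  unfold pow_gap_t3. auto_derive.
  repeat split; eexists; now apply is_derive_pow_factor_t.
Qed.

(** * Asymptotics of the gaps at minus infinity *)

Lemma exp_mult_le (k j t : R) : t < 0 -> k <= j -> exp (j * t) <= exp (k * t).
Proof.
  intros Ht Hkj. destruct (Req_dec k j) as [->|]; [lra|].
  left. apply exp_increasing. nra.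
Qed.

Lemma geom_gap_far (w k t : R) : 0 < w < 1 -> k <= w -> t < 0 ->
  Rabs (geom_gap w t - (1 - w)) <= exp (k * t).
Proof.
  intros Hw Hk Ht. unfold geom_gap, arith_mean.
  assert (H1 := exp_mult_le k 1 t Ht ltac:(lra)). rewrite Rmult_1_l in H1.
  assert (H2 := exp_mult_le k w t Ht Hk).
  generalize (exp_pos t) (exp_pos (w * t)). intros. apply Rabs_le. nra.
Qed.

(* Limit of the power mean as [t] tends to [- oo], for [alpha > 0]. *)
Definition pow_limit (alpha w : R) : R := exp (ln (1 - w) / alpha).

Lemma exp_sub_bounds (x y : R) : exp y * (x - y) <= exp x - exp y <= exp x * (x - y).
Proof.
  assert (Hx := exp_pos x). assert (Hy := exp_pos y). split.
  - assert (H := exp_ineq1_le (x - y)). replace (exp x) with (exp y * exp (x - y)).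
    + nra.
    + rewrite <- exp_plus. f_equal. ring.
  - assert (H := exp_ineq1_le (y - x)). replace (exp y) with (exp x * exp (y - x)).
    + nra.
    + rewrite <- exp_plus. f_equal. ring.
Qed.

Lemma ln_sub_bounds (x y : R) : 0 < x -> 0 < y ->
  (x - y) / x <= ln x - ln y <= (x - y) / y.
Proof.
  intros Hx Hy.
  assert (H := exp_sub_bounds (ln x) (ln y)). rewrite !exp_ln in H by assumption.
  split.
  - apply (proj2 (Rle_div_l _ _ _ Hx)). lra.
  - apply (proj1 (Rle_div_r _ _ _ Hy)). lra.
Qed.

(** Tangent bounds for [ln], then for [exp], applied to [pow_base - (1 - w) = w * exp (alpha * t)].
    Both sides matter: a minimum and a maximum of the ratio call for opposite estimates. *)
Lemma pow_mean_far_bounds (alpha w t : R) : 0 < w < 1 -> 0 < alpha -> t < 0 ->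
  pow_limit alpha w * (w / alpha) * exp (alpha * t)
    <= exp (ln (pow_base alpha w t) / alpha) - pow_limit alpha w
    <= w / ((1 - w) * alpha) * exp (alpha * t).
Proof.
  intros Hw Ha Ht.
  assert (HL := pow_base_pos alpha w t ltac:(lra)).
  assert (PX := exp_pos (alpha * t)).
  assert (HX : exp (alpha * t) < 1).
  { rewrite <- exp_0. apply exp_increasing. nra. }
  assert (HL1 : pow_base alpha w t <= 1) by (unfold pow_base; nra).
  assert (EL : pow_base alpha w t - (1 - w) = w * exp (alpha * t)) by (unfold pow_base; ring).
  assert (Hln := ln_sub_bounds (pow_base alpha w t) (1 - w) HL ltac:(lra)).
  rewrite EL in Hln.
  assert (Hl0 : ln (pow_base alpha w t) <= 0).
  { rewrite <- ln_1. apply ln_le; lra. }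
  unfold pow_limit.
  assert (He := exp_sub_bounds (ln (pow_base alpha w t) / alpha) (ln (1 - w) / alpha)).
  set (a := ln (pow_base alpha w t)) in *. set (b := ln (1 - w)) in *.
  assert (Hia := Rinv_0_lt_compat alpha Ha).
  replace (a / alpha - b / alpha) with ((a - b) * / alpha) in He by (field; lra).
  assert (P0 := exp_pos (b / alpha)).
  assert (P1 : exp (a / alpha) <= 1).
  { rewrite <- exp_0. destruct (Req_dec (a / alpha) 0) as [->|]; [lra|].
    left. apply exp_increasing. unfold Rdiv in *. nra. }
  assert (Pa := exp_pos (a / alpha)).
  assert (W0 : 0 < w * exp (alpha * t)) by nra.
  assert (W1 : w * exp (alpha * t) <= a - b).
  { apply Rle_trans with (2 := proj1 Hln).
    apply (proj1 (Rle_div_r _ _ _ HL)).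
    rewrite <- (Rmult_1_r (w * exp (alpha * t))) at 2. apply Rmult_le_compat_l; lra. }
  assert (W2 : w * exp (alpha * t) * / alpha <= (a - b) * / alpha) by nra.
  split.
  - apply Rle_trans with (2 := proj1 He).
    replace (exp (b / alpha) * (w / alpha) * exp (alpha * t))
      with (exp (b / alpha) * (w * exp (alpha * t) * / alpha)) by (unfold Rdiv; ring).
    nra.
  - apply Rle_trans with (1 := proj2 He).
    replace (w / ((1 - w) * alpha) * exp (alpha * t))
      with (w * exp (alpha * t) / (1 - w) * / alpha) by (field; lra).
    assert ((a - b) * / alpha <= w * exp (alpha * t) / (1 - w) * / alpha)
      by (apply Rmult_le_compat_r; lra).
    assert (0 <= (a - b) * / alpha) by nra. nra.
Qed.

Lemma pow_gap_far (alpha w k t : R) : 0 < w < 1 -> 0 < alpha -> k <= alpha -> k <= 1 ->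
  t < 0 -> Rabs (pow_gap alpha w t - (1 - w - pow_limit alpha w))
    <= (1 + w / ((1 - w) * alpha)) * exp (k * t).
Proof.
  intros Hw Ha Hk Hk1 Ht.
  assert (H := pow_mean_far_bounds alpha w t Hw Ha Ht).
  assert (H1 := exp_mult_le k 1 t Ht Hk1). rewrite Rmult_1_l in H1.
  assert (H2 := exp_mult_le k alpha t Ht Hk).
  assert (HC : 0 < w / ((1 - w) * alpha)) by (apply Rdiv_lt_0_compat; nra).
  assert (P0 : 0 < pow_limit alpha w) by apply exp_pos.
  assert (Hwa : 0 < w / alpha) by (apply Rdiv_lt_0_compat; lra).
  assert (PX := exp_pos (alpha * t)).
  assert (0 < pow_limit alpha w * (w / alpha) * exp (alpha * t))
    by (apply Rmult_lt_0_compat; [nra|exact PX]).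
  generalize (exp_pos t). intros. unfold pow_gap, arith_mean. apply Rabs_le.
  set (q := exp (ln (pow_base alpha w t) / alpha)) in *. nra.
Qed.

(** Since [pow_base >= w * exp (alpha * t)] and [alpha < 0], the power mean is at most
    [w ^ (1 / alpha) * exp t] and tends to [0]. *)
Lemma pow_gap_far_neg (alpha w k t : R) : 0 < w < 1 -> alpha < 0 -> k <= 1 -> t < 0 ->
  Rabs (pow_gap alpha w t - (1 - w)) <= (1 + exp (ln w / alpha)) * exp (k * t).
Proof.
  intros Hw Ha Hk Ht.
  assert (H1 := exp_mult_le k 1 t Ht Hk). rewrite Rmult_1_l in H1.
  assert (Hq : exp (ln (pow_base alpha w t) / alpha) <= exp (ln w / alpha) * exp t).
  { rewrite <- exp_plus.
    replace (ln w / alpha + t) with (ln (w * exp (alpha * t)) / alpha)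
      by (rewrite ln_mult, ln_exp by (try apply exp_pos; lra); field; lra).
    left. apply exp_increasing.
    assert (ln (w * exp (alpha * t)) < ln (pow_base alpha w t)).
    { generalize (exp_pos (alpha * t)). intros.
      apply ln_increasing; [nra|]. unfold pow_base. lra. }
    assert (/ alpha < 0) by (now apply Rinv_lt_0_compat). unfold Rdiv. nra. }
  generalize (exp_pos (ln (pow_base alpha w t) / alpha)) (exp_pos (ln w / alpha)) (exp_pos t).
  intros. unfold pow_gap, arith_mean. apply Rabs_le.
  set (q := exp (ln (pow_base alpha w t) / alpha)) in *. nra.
Qed.

Lemma exp_scaled_small (k a b : R) : 0 < k -> 0 < a -> 0 < b ->
  exists t, t < 0 /\ a * exp (k * t) < b.
Proof.
  intros Hk Ha Hb.
  destruct (exp_small_near_minus_infty k (b / a) Hk) as [M HM];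
    [now apply Rdiv_lt_0_compat|].
  exists (Rmin M 0 - 1). generalize (Rmin_l M 0) (Rmin_r M 0). intros. split; [lra|].
  specialize (HM (Rmin M 0 - 1) ltac:(lra)).
  apply (Rlt_div_r _ _ a Ha) in HM. lra.
Qed.

(** At [- oo] both gaps tend to [1 - w], so the ratio tends to [1] and lies below it everywhere: any
    test point works, here [-1]. At [0] the third-order difference [- alpha w (1 - w) (1 - 2 w)] is
    positive because [w < 1 / 2]. *)
Lemma gap_ratio_min_neg (alpha w : R) : alpha < 0 -> 0 < w < 1 / 2 ->
  exists t, t < 0 /\ forall y, y < 0 ->
    geom_gap w t / pow_gap alpha w t <= geom_gap w y / pow_gap alpha w y.
Proof.
  intros Ha Hw.
  destruct (geom_gap_jet_0 w) as [G0 [G1 [G2 G3]]].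
  destruct (pow_gap_jet_0 alpha w) as [Q0 [Q1 [Q2 Q3]]].
  assert (Hww : 0 < w * (1 - w)) by nra.
  apply (ratio_min_exists (geom_gap w) (geom_gap_t1 w) (geom_gap_t2 w) (geom_gap_t3 w)
    (pow_gap alpha w) (pow_gap_t1 alpha w) (pow_gap_t2 alpha w) (pow_gap_t3 alpha w)
    (1 / (1 - alpha)) (1 - w) (1 - w) (1 + exp (ln w / alpha)) w (-1)); try assumption;
    try (intros; apply is_derive_geom_gap_t); try (intros; apply is_derive_pow_gap_t; lra);
    try apply continuous_geom_gap_t3; try (apply continuous_pow_gap_t3; lra); try lra.
  - rewrite Q2. nra.
  - rewrite Q2, G2. field. lra.
  - rewrite Q3, G3.
    apply Rlt_0_minus.
    replace (_ - _) with (- alpha * (w * (1 - w)) * (1 - 2 * w)) by (field; lra).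
    apply Rmult_lt_0_compat; nra.
  - intros; apply geom_gap_pos; lra.
  - intros; apply pow_gap_pos; lra.
  - intros x Hx. apply Rle_trans with (1 := geom_gap_far w w x ltac:(lra) ltac:(lra) Hx).
    generalize (exp_pos (w * x)) (exp_pos (ln w / alpha)). nra.
  - intros; apply pow_gap_far_neg; lra.
  - generalize (geom_gap_lt_pow_gap alpha w (-1)). intros. nra.
Qed.

(** At [- oo] the term [exp (w * t)] of the geometric mean dominates [exp t] and lowers the ratio,
    while the error of the power mean only enlarges the denominator. The point [x1] makes
    [w (V0 + 1 - w) exp t < V0 exp (w t)]. *)
Lemma gap_ratio_min_above_one (alpha w : R) : 1 < alpha -> 1 / 2 < w < 1 ->
  exists t, t < 0 /\ forall y, y < 0 ->
    geom_gap w t / - pow_gap alpha w t <= geom_gap w y / - pow_gap alpha w y.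
Proof.
  intros Ha Hw.
  destruct (geom_gap_jet_0 w) as [G0 [G1 [G2 G3]]].
  destruct (pow_gap_jet_0 alpha w) as [Q0 [Q1 [Q2 Q3]]].
  assert (Hww : 0 < w * (1 - w)) by nra.
  set (V0 := pow_limit alpha w - (1 - w)).
  assert (HV0 : 0 < V0).
  { unfold V0, pow_limit. rewrite <- (exp_ln (1 - w)) at 2 by lra.
    apply Rlt_0_minus, exp_increasing.
    assert (ln (1 - w) < 0) by (rewrite <- ln_1; apply ln_increasing; lra).
    apply (proj1 (Rlt_div_r _ _ alpha ltac:(lra))). nra. }
  destruct (exp_scaled_small (1 - w) (w * (V0 + (1 - w))) V0) as [x1 [Hx1 Sx1]];
    [lra|nra|exact HV0|].
  assert (HC : 0 < w / ((1 - w) * alpha)) by (apply Rdiv_lt_0_compat; nra).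
  apply (ratio_min_exists (geom_gap w) (geom_gap_t1 w) (geom_gap_t2 w) (geom_gap_t3 w)
    (fun t => - pow_gap alpha w t) (fun t => - pow_gap_t1 alpha w t)
    (fun t => - pow_gap_t2 alpha w t) (fun t => - pow_gap_t3 alpha w t)
    (1 / (alpha - 1)) (1 - w) V0 (1 + w / ((1 - w) * alpha)) w x1); try assumption;
    try (intros; apply is_derive_geom_gap_t);
    try apply continuous_geom_gap_t3; try lra.
  - intros; apply (is_derive_opp (pow_gap alpha w)), is_derive_pow_gap_t; lra.
  - intros; apply (is_derive_opp (pow_gap_t1 alpha w)), is_derive_pow_gap_t; lra.
  - intros; apply (is_derive_opp (pow_gap_t2 alpha w)), is_derive_pow_gap_t; lra.
  - apply (continuous_opp (pow_gap_t3 alpha w)), continuous_pow_gap_t3; lra.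
  - rewrite Q2. nra.
  - rewrite Q2, G2. field. lra.
  - rewrite Q3, G3.
    apply Rlt_0_minus.
    replace (_ - _) with (alpha * (w * (1 - w)) * (2 * w - 1)) by (field; lra).
    apply Rmult_lt_0_compat; nra.
  - intros; apply geom_gap_pos; lra.
  - intros x Hx. generalize (pow_gap_neg alpha w x). lra.
  - intros x Hx. apply Rle_trans with (1 := geom_gap_far w w x ltac:(lra) ltac:(lra) Hx).
    generalize (exp_pos (w * x)). nra.
  - intros x Hx. replace (- pow_gap alpha w x - V0)
      with (- (pow_gap alpha w x - (1 - w - pow_limit alpha w))) by (unfold V0; ring).
    rewrite Rabs_Ropp. apply pow_gap_far; lra.
  - assert (E : exp x1 = exp (w * x1) * exp ((1 - w) * x1)).
    { rewrite <- exp_plus. f_equal. ring. }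
    assert (H := pow_mean_far_bounds alpha w x1 ltac:(lra) ltac:(lra) Hx1).
    assert (P0 : 0 < pow_limit alpha w) by apply exp_pos.
    assert (Hwa : 0 < w / alpha) by (apply Rdiv_lt_0_compat; lra).
    assert (PX := exp_pos (alpha * x1)).
    assert (0 < pow_limit alpha w * (w / alpha) * exp (alpha * x1))
      by (apply Rmult_lt_0_compat; [nra|exact PX]).
    assert (Pw := exp_pos (w * x1)).
    assert (Hk : w * (V0 + (1 - w)) * exp x1 < V0 * exp (w * x1)) by (rewrite E; nra).
    unfold geom_gap, pow_gap, arith_mean. unfold V0 in *.
    set (q := exp (ln (pow_base alpha w x1) / alpha)) in *. nra.
Qed.

Lemma pow_limit_lt (alpha w : R) : 0 < w < 1 -> 0 < alpha < 1 -> pow_limit alpha w < 1 - w.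
Proof.
  intros Hw Ha. unfold pow_limit. rewrite <- (exp_ln (1 - w)) at 2 by lra.
  apply exp_increasing.
  assert (ln (1 - w) < 0) by (rewrite <- ln_1; apply ln_increasing; lra).
  apply (proj2 (Rlt_div_l _ _ alpha ltac:(lra))). nra.
Qed.

(** At [- oo] the term [exp (w * t)] of the geometric mean lowers the ratio and [exp (alpha * t)] of
    the power mean raises it; [w < alpha] lets the first win, which provides [x1]. *)
Lemma gap_ratio_min_middle (alpha w : R) : 1 / 2 < alpha < 1 -> 1 / 2 < w < alpha ->
  exists t, t < 0 /\ forall y, y < 0 ->
    geom_gap w t / pow_gap alpha w t <= geom_gap w y / pow_gap alpha w y.
Proof.
  intros Ha Hw.
  destruct (geom_gap_jet_0 w) as [G0 [G1 [G2 G3]]].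
  destruct (pow_gap_jet_0 alpha w) as [Q0 [Q1 [Q2 Q3]]].
  assert (Hww : 0 < w * (1 - w)) by nra.
  set (V0 := 1 - w - pow_limit alpha w).
  assert (HV0 : 0 < V0) by (generalize (pow_limit_lt alpha w); unfold V0; lra).
  assert (HC : 0 < w / ((1 - w) * alpha)) by (apply Rdiv_lt_0_compat; nra).
  destruct (exp_scaled_small (alpha - w) ((1 - w) * (w / ((1 - w) * alpha))) V0)
    as [x1 [Hx1 Sx1]]; [lra|nra|exact HV0|].
  apply (ratio_min_exists (geom_gap w) (geom_gap_t1 w) (geom_gap_t2 w) (geom_gap_t3 w)
    (pow_gap alpha w) (pow_gap_t1 alpha w) (pow_gap_t2 alpha w) (pow_gap_t3 alpha w)
    (1 / (1 - alpha)) (1 - w) V0 (1 + w / ((1 - w) * alpha)) w x1); try assumption;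
    try (intros; apply is_derive_geom_gap_t); try (intros; apply is_derive_pow_gap_t; lra);
    try apply continuous_geom_gap_t3; try (apply continuous_pow_gap_t3; lra); try lra.
  - rewrite Q2. nra.
  - rewrite Q2, G2. field. lra.
  - rewrite Q3, G3.
    apply Rlt_0_minus.
    replace (_ - _) with (alpha * (w * (1 - w)) * (2 * w - 1)) by (field; lra).
    apply Rmult_lt_0_compat; nra.
  - intros; apply geom_gap_pos; lra.
  - intros; apply pow_gap_pos; lra.
  - intros x Hx. apply Rle_trans with (1 := geom_gap_far w w x ltac:(lra) ltac:(lra) Hx).
    generalize (exp_pos (w * x)). nra.
  - intros; apply pow_gap_far; lra.
  - assert (E : exp (alpha * x1) = exp (w * x1) * exp ((alpha - w) * x1)).
    { rewrite <- exp_plus. f_equal. ring. }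
    assert (H := pow_mean_far_bounds alpha w x1 ltac:(lra) ltac:(lra) Hx1).
    assert (P0 : 0 < pow_limit alpha w) by apply exp_pos.
    assert (Pw := exp_pos (w * x1)). assert (Px := exp_pos x1).
    assert (Hk : (1 - w) * (w / ((1 - w) * alpha)) * exp (alpha * x1) < V0 * exp (w * x1))
      by (rewrite E; nra).
    assert (0 < w * exp x1) by nra.
    set (Q := w / ((1 - w) * alpha) * exp (alpha * x1)) in *.
    assert (Hk' : (1 - w) * Q < V0 * exp (w * x1)) by (unfold Q; lra).
    unfold geom_gap, pow_gap, arith_mean. unfold V0 in *.
    set (q := exp (ln (pow_base alpha w x1) / alpha)) in *. nra.
Qed.

(** Obtained as a minimum of the reciprocal. As [alpha < w], the error of the power mean decays more
    slowly and carries the ratio above its limit. *)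
Lemma gap_ratio_max_low (alpha w : R) : 0 < alpha < 1 / 2 -> alpha < w < 1 / 2 ->
  exists t, t < 0 /\ forall y, y < 0 ->
    geom_gap w y / pow_gap alpha w y <= geom_gap w t / pow_gap alpha w t.
Proof.
  intros Ha Hw.
  assert (PA : forall x, x < 0 -> 0 < geom_gap w x) by (intros; apply geom_gap_pos; lra).
  assert (PB : forall x, x < 0 -> 0 < pow_gap alpha w x) by (intros; apply pow_gap_pos; lra).
  enough (exists t, t < 0 /\ forall y, y < 0 ->
    pow_gap alpha w t / geom_gap w t <= pow_gap alpha w y / geom_gap w y) as [t [Ht Hm]].
  { exists t. split; [exact Ht|]. intros y Hy. specialize (Hm y Hy).
    assert (At := PA t Ht). assert (Ay := PA y Hy).
    assert (Bt := PB t Ht). assert (By := PB y Hy).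
    replace (geom_gap w t / pow_gap alpha w t) with (/ (pow_gap alpha w t / geom_gap w t))
      by (field; lra).
    replace (geom_gap w y / pow_gap alpha w y) with (/ (pow_gap alpha w y / geom_gap w y))
      by (field; lra).
    apply Rinv_le_contravar; [now apply Rdiv_lt_0_compat|exact Hm]. }
  destruct (geom_gap_jet_0 w) as [G0 [G1 [G2 G3]]].
  destruct (pow_gap_jet_0 alpha w) as [Q0 [Q1 [Q2 Q3]]].
  assert (Hww : 0 < w * (1 - w)) by nra.
  set (U0 := 1 - w - pow_limit alpha w).
  assert (HU0 : 0 < U0) by (generalize (pow_limit_lt alpha w); unfold U0; lra).
  assert (HC : 0 < w / ((1 - w) * alpha)) by (apply Rdiv_lt_0_compat; nra).
  assert (P0 : 0 < pow_limit alpha w) by apply exp_pos.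
  assert (Hwa : 0 < w / alpha) by (apply Rdiv_lt_0_compat; lra).
  assert (Hpw : 0 < pow_limit alpha w * (w / alpha)) by nra.
  destruct (exp_scaled_small (w - alpha) (w * pow_limit alpha w + U0)
    ((1 - w) * (pow_limit alpha w * (w / alpha)))) as [x1 [Hx1 Sx1]]; [lra|nra|nra|].
  apply (ratio_min_exists
    (pow_gap alpha w) (pow_gap_t1 alpha w) (pow_gap_t2 alpha w) (pow_gap_t3 alpha w)
    (geom_gap w) (geom_gap_t1 w) (geom_gap_t2 w) (geom_gap_t3 w)
    (1 - alpha) U0 (1 - w) (1 + w / ((1 - w) * alpha)) alpha x1); try assumption;
    try (intros; apply is_derive_geom_gap_t); try (intros; apply is_derive_pow_gap_t; lra);
    try apply continuous_geom_gap_t3; try (apply continuous_pow_gap_t3; lra); try lra.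
  - rewrite Q2, G2. ring.
  - rewrite Q3, G3.
    apply Rlt_0_minus.
    replace (_ - _) with ((1 - alpha) * (alpha * ((w * (1 - w)) * (1 - 2 * w)))) by ring.
    apply Rmult_lt_0_compat; [lra|]. apply Rmult_lt_0_compat; nra.
  - intros; apply pow_gap_far; lra.
  - intros x Hx. apply Rle_trans with (1 := geom_gap_far w alpha x ltac:(lra) ltac:(lra) Hx).
    generalize (exp_pos (alpha * x)). nra.
  - assert (E : exp (w * x1) = exp (alpha * x1) * exp ((w - alpha) * x1)).
    { rewrite <- exp_plus. f_equal. ring. }
    assert (H := pow_mean_far_bounds alpha w x1 ltac:(lra) ltac:(lra) Hx1).
    assert (Pw := exp_pos (w * x1)). assert (Pa := exp_pos (alpha * x1)).
    assert (H1 := exp_mult_le w 1 x1 Hx1 ltac:(lra)). rewrite Rmult_1_l in H1.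
    assert (Hk : (w * pow_limit alpha w + U0) * exp (w * x1)
      < (1 - w) * (pow_limit alpha w * (w / alpha)) * exp (alpha * x1)) by (rewrite E; nra).
    assert (Hq : (1 - w) * (pow_limit alpha w * (w / alpha) * exp (alpha * x1))
      <= (1 - w) * (exp (ln (pow_base alpha w x1) / alpha) - pow_limit alpha w))
      by (apply Rmult_le_compat_l; lra).
    assert (He : w * pow_limit alpha w * exp x1 <= w * pow_limit alpha w * exp (w * x1)).
    { apply Rmult_le_compat_l; nra. }
    unfold geom_gap, pow_gap, arith_mean. unfold U0 in *.
    set (q := exp (ln (pow_base alpha w x1) / alpha)) in *. nra.
Qed.

(** * Monotonicity and limits in n *)

(** [epsilon] returns an attained minimum once one is exhibited, and attained minima are unique. *)
Lemma min_on_reparam (h phi : R -> R) (a b t0 : R) :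
  (forall t, t < 0 -> exists x, a < x < b /\ h x = phi t) ->
  (forall x, a < x < b -> exists t, t < 0 /\ h x = phi t) ->
  t0 < 0 -> (forall t, t < 0 -> phi t0 <= phi t) -> min_on h a b = phi t0.
Proof.
  intros Hto Hfrom Ht0 Hmin.
  assert (Hm : is_min_on h a b (phi t0)).
  { split; [now apply Hto|]. intros x Hx. destruct (Hfrom x Hx) as [t [Ht ->]]. auto. }
  assert (He : is_min_on h a b (min_on h a b)).
  { exact (epsilon_spec (inhabits 0) (is_min_on h a b) (ex_intro _ _ Hm)). }
  destruct Hm as [[x [Ix Ex]] Lx]. destruct He as [[y [Iy Ey]] Ly].
  apply Rle_antisym; [rewrite <- Ex; now apply Ly|rewrite <- Ey; now apply Lx].
Qed.

Lemma max_on_reparam (h phi : R -> R) (a b t0 : R) :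
  (forall t, t < 0 -> exists x, a < x < b /\ h x = phi t) ->
  (forall x, a < x < b -> exists t, t < 0 /\ h x = phi t) ->
  t0 < 0 -> (forall t, t < 0 -> phi t <= phi t0) -> max_on h a b = phi t0.
Proof.
  intros Hto Hfrom Ht0 Hmin.
  assert (Hm : is_max_on h a b (phi t0)).
  { split; [now apply Hto|]. intros x Hx. destruct (Hfrom x Hx) as [t [Ht ->]]. auto. }
  assert (He : is_max_on h a b (max_on h a b)).
  { exact (epsilon_spec (inhabits 0) (is_max_on h a b) (ex_intro _ _ Hm)). }
  destruct Hm as [[x [Ix Ex]] Lx]. destruct He as [[y [Iy Ey]] Ly].
  apply Rle_antisym; [rewrite <- Ey; now apply Lx|rewrite <- Ex; now apply Ly].
Qed.

Lemma g_exp_ln (n : nat) (x : R) : (2 < n)%nat -> 0 < x -> 0 < 1 - (INR n - 1) * x ->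
  g n x = exp (((INR n - 1) * ln x + ln (1 - (INR n - 1) * x)) / INR n).
Proof.
  intros Hn Hx Hy. unfold g, Rpower.
  rewrite ln_mult, ln_pow, minus_INR by (try apply pow_lt; try assumption; lia).
  f_equal. simpl INR. unfold Rdiv. ring.
Qed.

Lemma p_exp_ln (n : nat) (alpha x : R) : alpha <> 0 ->
  p n alpha x = exp (ln (((INR n - 1) * exp (alpha * ln x)
    + exp (alpha * ln (1 - (INR n - 1) * x))) / INR n) / alpha).
Proof.
  intros Ha. unfold p, Rpower. replace (1 / (1 / alpha)) with alpha by (field; exact Ha).
  f_equal. unfold Rdiv. ring.
Qed.

Lemma INR_gt_2 (n : nat) : (2 < n)%nat -> 3 <= INR n.
Proof. intros Hn. apply (le_INR 3) in Hn. simpl in Hn. lra. Qed.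

(** Homogeneity: the scale [a] is a common factor of all three means and cancels. The constant
    [1 / INR n] is the arithmetic mean, as the tuple sums to [1]. *)
Lemma f_as_gap_ratio (n : nat) (alpha x a w t : R) : alpha <> 0 ->
  g n x = a * exp (w * t) -> p n alpha x = a * exp (ln (pow_base alpha w t) / alpha) ->
  1 / INR n = a * arith_mean w t -> 0 < a -> pow_gap alpha w t <> 0 ->
  f n alpha x = geom_gap w t / pow_gap alpha w t.
Proof.
  intros Ha Eg Ep En Pa HB. unfold f. rewrite Eg, Ep, En.
  unfold geom_gap, pow_gap in *.
  rewrite <- !Rmult_minus_distr_l. field. repeat split; lra.
Qed.

(** For [t < 0] the repeated value [x] is the largest, and the single smaller entry [x * exp t] has
    weight [1 / n]. *)
Lemma f_at_low (n : nat) (alpha x t : R) : (2 < n)%nat -> alpha <> 0 ->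
  0 < x -> 1 - (INR n - 1) * x = x * exp t -> pow_gap alpha (1 / INR n) t <> 0 ->
  f n alpha x = geom_gap (1 / INR n) t / pow_gap alpha (1 / INR n) t.
Proof.
  intros Hn Ha Hx Hy HB. assert (N3 := INR_gt_2 n Hn). assert (Pt := exp_pos t).
  assert (Ey : ln (x * exp t) = ln x + t) by (rewrite ln_mult, ln_exp; auto).
  apply (f_as_gap_ratio n alpha x x); auto.
  - rewrite g_exp_ln by (auto; rewrite Hy; nra). rewrite Hy, Ey.
    rewrite <- (exp_ln x) at 3 by exact Hx. rewrite <- exp_plus. f_equal. field. lra.
  - rewrite p_exp_ln by exact Ha. rewrite Hy, Ey.
    replace (((INR n - 1) * exp (alpha * ln x) + exp (alpha * (ln x + t))) / INR n)
      with (exp (alpha * ln x) * pow_base alpha (1 / INR n) t).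
    + rewrite ln_mult, ln_exp; [|apply exp_pos|apply pow_base_pos].
      * rewrite <- (exp_ln x) at 2 by exact Hx. rewrite <- exp_plus. f_equal. field. exact Ha.
      * split; [apply Rdiv_le_0_compat; lra|apply (proj2 (Rle_div_l _ _ (INR n) ltac:(lra))); lra].
    + unfold pow_base. rewrite (Rmult_plus_distr_l alpha), (exp_plus (alpha * ln x)). field. lra.
  - unfold arith_mean.
    replace (x * (1 - 1 / INR n + 1 / INR n * exp t))
      with (((INR n - 1) * x + x * exp t) / INR n) by (field; lra).
    rewrite <- Hy. field. lra.
Qed.

(** For [t < 0] the single entry [y] is the largest, and the other [n - 1] equal [y * exp t]. *)
Lemma f_at_high (n : nat) (alpha y t : R) : (2 < n)%nat -> alpha <> 0 ->
  0 < y -> 1 - (INR n - 1) * (y * exp t) = y -> pow_gap alpha (1 - 1 / INR n) t <> 0 ->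
  f n alpha (y * exp t) = geom_gap (1 - 1 / INR n) t / pow_gap alpha (1 - 1 / INR n) t.
Proof.
  intros Hn Ha Hy E HB. assert (N3 := INR_gt_2 n Hn). assert (Pt := exp_pos t).
  assert (Ey : ln (y * exp t) = ln y + t) by (rewrite ln_mult, ln_exp; auto).
  apply (f_as_gap_ratio n alpha (y * exp t) y); auto.
  - rewrite g_exp_ln by (try rewrite E; try apply Rmult_lt_0_compat; auto). rewrite E, Ey.
    rewrite <- (exp_ln y) at 3 by exact Hy. rewrite <- exp_plus. f_equal. field. lra.
  - rewrite p_exp_ln by exact Ha. rewrite E, Ey.
    replace (((INR n - 1) * exp (alpha * (ln y + t)) + exp (alpha * ln y)) / INR n)
      with (exp (alpha * ln y) * pow_base alpha (1 - 1 / INR n) t).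
    + rewrite ln_mult, ln_exp; [|apply exp_pos|apply pow_base_pos].
      * rewrite <- (exp_ln y) at 2 by exact Hy. rewrite <- exp_plus. f_equal. field. exact Ha.
      * assert (0 <= 1 / INR n) by (apply Rdiv_le_0_compat; lra).
        assert (1 / INR n <= 1) by (apply (proj2 (Rle_div_l _ _ (INR n) ltac:(lra))); lra).
        lra.
    + unfold pow_base. rewrite (Rmult_plus_distr_l alpha), (exp_plus (alpha * ln y)). field. lra.
  - unfold arith_mean.
    replace (y * (1 - (1 - 1 / INR n) + (1 - 1 / INR n) * exp t))
      with ((y + (INR n - 1) * (y * exp t)) / INR n) by (field; lra).
    rewrite <- E at 1. field. lra.
Qed.

Lemma inv_INR_bounds (n : nat) : (2 < n)%nat -> 0 < 1 / INR n < 1 / 2.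
Proof.
  intros Hn. assert (N3 := INR_gt_2 n Hn).
  split; [apply Rdiv_lt_0_compat; lra|].
  apply (proj2 (Rlt_div_l _ _ (INR n) ltac:(lra))). lra.
Qed.

Lemma pow_gap_neq_0 (alpha w t : R) :
  0 < w < 1 -> t < 0 -> alpha <> 0 -> alpha <> 1 -> pow_gap alpha w t <> 0.
Proof.
  intros Hw Ht H0 H1. destruct (Rlt_or_le alpha 1).
  - generalize (pow_gap_pos alpha w t). lra.
  - generalize (pow_gap_neg alpha w t). lra.
Qed.

Lemma f_param_low (n : nat) (alpha : R) : (2 < n)%nat -> alpha <> 0 -> alpha <> 1 ->
  (forall t, t < 0 -> exists x, 1 / INR n < x < 1 / (INR n - 1) /\
     f n alpha x = geom_gap (1 / INR n) t / pow_gap alpha (1 / INR n) t) /\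
  (forall x, 1 / INR n < x < 1 / (INR n - 1) -> exists t, t < 0 /\
     f n alpha x = geom_gap (1 / INR n) t / pow_gap alpha (1 / INR n) t).
Proof.
  intros Hn H0 H1. assert (N3 := INR_gt_2 n Hn). assert (Hw := inv_INR_bounds n Hn).
  split.
  - intros t Ht. assert (Pt := exp_pos t).
    assert (Lt : exp t < 1) by (rewrite <- exp_0; now apply exp_increasing).
    (* The solution of [(n - 1) x + x exp t = 1]. *)
    exists (1 / (INR n - 1 + exp t)). split.
    + unfold Rdiv. rewrite !Rmult_1_l. split; apply Rinv_lt_contravar; nra.
    + apply f_at_low; auto.
      * apply Rdiv_lt_0_compat; lra.
      * field. lra.
      * apply pow_gap_neq_0; auto; lra.
  - intros x [Hx1 Hx2].
    apply (Rlt_div_l 1 x (INR n)) in Hx1; [|lra].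
    apply (Rlt_div_r x 1 (INR n - 1)) in Hx2; [|lra].
    assert (Px : 0 < x) by nra.
    assert (Py : 0 < (1 - (INR n - 1) * x) / x) by (apply Rdiv_lt_0_compat; lra).
    assert (Ht : ln ((1 - (INR n - 1) * x) / x) < 0).
    { rewrite <- ln_1. apply ln_increasing; [exact Py|].
      apply (proj2 (Rlt_div_l _ _ x Px)). lra. }
    exists (ln ((1 - (INR n - 1) * x) / x)). split; [exact Ht|].
    apply f_at_low; auto.
    + rewrite exp_ln by exact Py. field. lra.
    + apply pow_gap_neq_0; auto; lra.
Qed.

Lemma f_param_high (n : nat) (alpha : R) : (2 < n)%nat -> alpha <> 0 -> alpha <> 1 ->
  (forall t, t < 0 -> exists x, 0 < x < 1 / INR n /\
     f n alpha x = geom_gap (1 - 1 / INR n) t / pow_gap alpha (1 - 1 / INR n) t) /\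
  (forall x, 0 < x < 1 / INR n -> exists t, t < 0 /\
     f n alpha x = geom_gap (1 - 1 / INR n) t / pow_gap alpha (1 - 1 / INR n) t).
Proof.
  intros Hn H0 H1. assert (N3 := INR_gt_2 n Hn). assert (Hw := inv_INR_bounds n Hn).
  split.
  - intros t Ht. assert (Pt := exp_pos t).
    assert (Lt : exp t < 1) by (rewrite <- exp_0; now apply exp_increasing).
    assert (PD : 0 < 1 + (INR n - 1) * exp t) by nra.
    (* Here [x = y exp t], where [y] solves [y + (n - 1) y exp t = 1]. *)
    exists (1 / (1 + (INR n - 1) * exp t) * exp t). split.
    + split.
      * apply Rmult_lt_0_compat; [apply Rdiv_lt_0_compat; lra|exact Pt].
      * replace (1 / (1 + (INR n - 1) * exp t) * exp t)
          with (exp t / (1 + (INR n - 1) * exp t)) by (field; lra).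
        apply (proj2 (Rlt_div_l _ _ _ PD)).
        apply (Rmult_lt_reg_l (INR n)); [lra|].
        replace (INR n * (1 / INR n * (1 + (INR n - 1) * exp t)))
          with (1 + (INR n - 1) * exp t) by (field; lra). nra.
    + apply f_at_high; auto.
      * apply Rdiv_lt_0_compat; lra.
      * field. lra.
      * apply pow_gap_neq_0; auto; lra.
  - intros x [Px Hx2].
    apply (Rlt_div_r x 1 (INR n)) in Hx2; [|lra].
    set (y := 1 - (INR n - 1) * x). assert (Hxy : 0 < x < y) by (unfold y; nra).
    assert (Py : 0 < x / y) by (apply Rdiv_lt_0_compat; lra).
    assert (Ht : ln (x / y) < 0).
    { rewrite <- ln_1. apply ln_increasing; [exact Py|].
      apply (proj2 (Rlt_div_l _ _ y ltac:(lra))). lra. }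
    assert (Ex : x = y * exp (ln (x / y))) by (rewrite exp_ln by exact Py; field; lra).
    exists (ln (x / y)). split; [exact Ht|].
    rewrite Ex at 1. apply f_at_high; auto; try lra.
    + rewrite <- Ex. reflexivity.
    + apply pow_gap_neq_0; auto; lra.
Qed.

(** [x / (x - 1) = 1 + 1 / (x - 1)] decreases on each side of its pole; the product hypothesis puts
    [a] and [b] on the same side. *)
Lemma div_pred_decreasing (a b : R) :
  0 < (a - 1) * (b - 1) -> a < b -> b / (b - 1) < a / (a - 1).
Proof.
  intros H Hab.
  assert (a - 1 <> 0) by (intros E; rewrite E in H; lra).
  assert (b - 1 <> 0) by (intros E; rewrite E in H; lra).
  apply Rlt_0_minus.
  replace (a / (a - 1) - b / (b - 1)) with ((b - a) / ((a - 1) * (b - 1)))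
    by (field; lra).
  apply Rdiv_lt_0_compat; lra.
Qed.

Lemma inv_INR_decreasing (m n : nat) : (2 < m)%nat -> (m < n)%nat -> 1 / INR n < 1 / INR m.
Proof.
  intros Hm Hmn. assert (M3 := INR_gt_2 m Hm). apply lt_INR in Hmn.
  unfold Rdiv. rewrite !Rmult_1_l. apply Rinv_lt_contravar; nra.
Qed.

Lemma nu1_attained (n : nat) (alpha : R) : (2 < n)%nat -> alpha < 0 ->
  exists t, t < 0 /\ nu1 n alpha = geom_gap (1 / INR n) t / pow_gap alpha (1 / INR n) t /\
    forall y, y < 0 -> nu1 n alpha <= geom_gap (1 / INR n) y / pow_gap alpha (1 / INR n) y.
Proof.
  intros Hn Ha. assert (Hw := inv_INR_bounds n Hn).
  destruct (gap_ratio_min_neg alpha (1 / INR n)) as [t [Ht Hm]]; try lra.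
  destruct (f_param_low n alpha) as [H1 H2]; try lra; auto.
  assert (E : nu1 n alpha = geom_gap (1 / INR n) t / pow_gap alpha (1 / INR n) t)
    by now apply (min_on_reparam _
      (fun t => geom_gap (1 / INR n) t / pow_gap alpha (1 / INR n) t)).
  exists t. rewrite E. auto.
Qed.

Lemma nu2_attained (n : nat) (alpha : R) : (2 < n)%nat -> 1 < alpha ->
  exists t, t < 0 /\
    nu2 n alpha = - (geom_gap (1 - 1 / INR n) t / - pow_gap alpha (1 - 1 / INR n) t) /\
    forall y, y < 0 ->
      - (geom_gap (1 - 1 / INR n) y / - pow_gap alpha (1 - 1 / INR n) y) <= nu2 n alpha.
Proof.
  intros Hn Ha. assert (Hw := inv_INR_bounds n Hn). set (w := 1 - 1 / INR n).
  destruct (gap_ratio_min_above_one alpha w) as [t [Ht Hm]]; try (unfold w; lra).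
  destruct (f_param_high n alpha) as [H1 H2]; try lra; auto. fold w in H1, H2.
  assert (E0 : forall y, y < 0 -> geom_gap w y / pow_gap alpha w y
    = - (geom_gap w y / - pow_gap alpha w y)).
  { intros y Hy. field. apply pow_gap_neq_0; unfold w; lra. }
  assert (E : nu2 n alpha = geom_gap w t / pow_gap alpha w t).
  { apply (max_on_reparam _ (fun t => geom_gap w t / pow_gap alpha w t)); auto.
    intros y Hy. rewrite !E0 by assumption. apply Ropp_le_contravar. auto. }
  exists t. rewrite E, E0 by exact Ht. repeat split; auto.
  intros y Hy. apply Ropp_le_contravar. auto.
Qed.

Lemma nu3_attained (n : nat) (alpha : R) : (2 < n)%nat -> 1 / 2 < alpha < 1 ->
  INR n < 1 / (1 - alpha) ->
  exists t, t < 0 /\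
    nu3 n alpha = geom_gap (1 - 1 / INR n) t / pow_gap alpha (1 - 1 / INR n) t /\
    forall y, y < 0 ->
      nu3 n alpha <= geom_gap (1 - 1 / INR n) y / pow_gap alpha (1 - 1 / INR n) y.
Proof.
  intros Hn Ha HI. assert (Hw := inv_INR_bounds n Hn). assert (N3 := INR_gt_2 n Hn).
  set (w := 1 - 1 / INR n).
  (* The upper bound on [n], read as a bound on the weight. *)
  assert (Hwa : w < alpha).
  { apply (Rlt_div_r _ _ (1 - alpha)) in HI; [|lra].
    enough (1 - alpha < 1 / INR n) by (unfold w; lra).
    apply (proj1 (Rlt_div_r _ _ (INR n) ltac:(lra))). lra. }
  destruct (gap_ratio_min_middle alpha w) as [t [Ht Hm]]; try (unfold w in *; lra).
  destruct (f_param_high n alpha) as [H1 H2]; try lra; auto. fold w in H1, H2.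
  assert (E : nu3 n alpha = geom_gap w t / pow_gap alpha w t)
    by now apply (min_on_reparam _ (fun t => geom_gap w t / pow_gap alpha w t)).
  exists t. rewrite E. auto.
Qed.

Lemma nu4_attained (n : nat) (alpha : R) : (2 < n)%nat -> 0 < alpha < 1 / 2 ->
  INR n < 1 / alpha ->
  exists t, t < 0 /\ nu4 n alpha = geom_gap (1 / INR n) t / pow_gap alpha (1 / INR n) t /\
    forall y, y < 0 -> geom_gap (1 / INR n) y / pow_gap alpha (1 / INR n) y <= nu4 n alpha.
Proof.
  intros Hn Ha HI. assert (Hw := inv_INR_bounds n Hn). assert (N3 := INR_gt_2 n Hn).
  assert (Hwa : alpha < 1 / INR n).
  { apply (Rlt_div_r _ _ alpha) in HI; [|lra].
    apply (proj1 (Rlt_div_r _ _ (INR n) ltac:(lra))). lra. }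
  destruct (gap_ratio_max_low alpha (1 / INR n)) as [t [Ht Hm]]; try lra.
  destruct (f_param_low n alpha) as [H1 H2]; try lra; auto.
  assert (E : nu4 n alpha = geom_gap (1 / INR n) t / pow_gap alpha (1 / INR n) t)
    by now apply (max_on_reparam _
      (fun t => geom_gap (1 / INR n) t / pow_gap alpha (1 / INR n) t)).
  exists t. rewrite E. auto.
Qed.

Lemma nu1_bounds (n : nat) (alpha : R) : (2 < n)%nat -> alpha < 0 -> 0 < nu1 n alpha < 1.
Proof.
  intros Hn Ha. assert (Hw := inv_INR_bounds n Hn).
  destruct (nu1_attained n alpha Hn Ha) as [t [Ht [-> _]]].
  assert (A := geom_gap_pos (1 / INR n) t ltac:(lra) ltac:(lra)).
  assert (AB := geom_gap_lt_pow_gap alpha (1 / INR n) t ltac:(lra) Ha ltac:(lra)).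
  split; [apply Rdiv_lt_0_compat; lra|].
  apply (proj2 (Rlt_div_l _ _ (pow_gap alpha (1 / INR n) t) ltac:(lra))). lra.
Qed.

Lemma nu1_decreasing (m n : nat) (alpha : R) : (2 < m)%nat -> (m < n)%nat -> alpha < 0 ->
  nu1 n alpha < nu1 m alpha.
Proof.
  intros Hm Hmn Ha.
  destruct (nu1_attained m alpha Hm Ha) as [t [Ht [-> _]]].
  destruct (nu1_attained n alpha ltac:(lia) Ha) as [_ [_ [_ Hmin]]].
  apply Rle_lt_trans with (1 := Hmin t Ht).
  assert (Hw := inv_INR_bounds m Hm). assert (Hw' := inv_INR_bounds n ltac:(lia)).
  apply gap_ratio_increasing_neg; try lra. now apply inv_INR_decreasing.
Qed.

Lemma nu2_neg (n : nat) (alpha : R) : (2 < n)%nat -> 1 < alpha -> nu2 n alpha < 0.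
Proof.
  intros Hn Ha. assert (Hw := inv_INR_bounds n Hn).
  destruct (nu2_attained n alpha Hn Ha) as [t [Ht [-> _]]].
  apply Ropp_lt_gt_0_contravar. apply Rdiv_lt_0_compat.
  - apply geom_gap_pos; lra.
  - generalize (pow_gap_neg alpha (1 - 1 / INR n) t). lra.
Qed.

Lemma nu2_increasing (m n : nat) (alpha : R) : (2 < m)%nat -> (m < n)%nat -> 1 < alpha ->
  nu2 m alpha < nu2 n alpha.
Proof.
  intros Hm Hmn Ha.
  destruct (nu2_attained m alpha Hm Ha) as [t [Ht [-> _]]].
  destruct (nu2_attained n alpha ltac:(lia) Ha) as [_ [_ [_ Hmax]]].
  apply Rlt_le_trans with (2 := Hmax t Ht).
  assert (Hw := inv_INR_bounds m Hm). assert (Hw' := inv_INR_bounds n ltac:(lia)).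
  assert (Hi := inv_INR_decreasing m n Hm Hmn).
  apply Ropp_lt_contravar. apply gap_ratio_decreasing_above_one; lra.
Qed.

Lemma nu3_gt_1 (n : nat) (alpha : R) : (2 < n)%nat -> 1 / 2 < alpha < 1 ->
  INR n < 1 / (1 - alpha) -> 1 < nu3 n alpha.
Proof.
  intros Hn Ha HI. assert (Hw := inv_INR_bounds n Hn).
  destruct (nu3_attained n alpha Hn Ha HI) as [t [Ht [-> _]]].
  assert (B := pow_gap_pos alpha (1 - 1 / INR n) t ltac:(lra) ltac:(lra) ltac:(lra) ltac:(lra)).
  apply (proj1 (Rlt_div_r _ _ _ B)). rewrite Rmult_1_l.
  apply pow_gap_lt_geom_gap; lra.
Qed.

Lemma nu3_decreasing (m n : nat) (alpha : R) : (2 < m)%nat -> (m < n)%nat ->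
  1 / 2 < alpha < 1 -> INR n < 1 / (1 - alpha) -> nu3 n alpha < nu3 m alpha.
Proof.
  intros Hm Hmn Ha HI. assert (Hlt := lt_INR m n Hmn).
  destruct (nu3_attained m alpha Hm Ha ltac:(lra)) as [t [Ht [-> _]]].
  destruct (nu3_attained n alpha ltac:(lia) Ha HI) as [_ [_ [_ Hmin]]].
  apply Rle_lt_trans with (1 := Hmin t Ht).
  assert (Hw := inv_INR_bounds m Hm). assert (Hw' := inv_INR_bounds n ltac:(lia)).
  assert (Hi := inv_INR_decreasing m n Hm Hmn).
  apply gap_ratio_decreasing_middle; lra.
Qed.

Lemma nu4_gt_1 (n : nat) (alpha : R) : (2 < n)%nat -> 0 < alpha < 1 / 2 ->
  INR n < 1 / alpha -> 1 < nu4 n alpha.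
Proof.
  intros Hn Ha HI. assert (Hw := inv_INR_bounds n Hn).
  destruct (nu4_attained n alpha Hn Ha HI) as [t [Ht [-> _]]].
  assert (B := pow_gap_pos alpha (1 / INR n) t ltac:(lra) ltac:(lra) ltac:(lra) ltac:(lra)).
  apply (proj1 (Rlt_div_r _ _ _ B)). rewrite Rmult_1_l.
  apply pow_gap_lt_geom_gap; lra.
Qed.

Lemma nu4_increasing (m n : nat) (alpha : R) : (2 < m)%nat -> (m < n)%nat ->
  0 < alpha < 1 / 2 -> INR n < 1 / alpha -> nu4 m alpha < nu4 n alpha.
Proof.
  intros Hm Hmn Ha HI. assert (Hlt := lt_INR m n Hmn).
  destruct (nu4_attained m alpha Hm Ha ltac:(lra)) as [t [Ht [-> _]]].
  destruct (nu4_attained n alpha ltac:(lia) Ha HI) as [_ [_ [_ Hmax]]].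
  apply Rlt_le_trans with (2 := Hmax t Ht).
  assert (Hw := inv_INR_bounds m Hm). assert (Hw' := inv_INR_bounds n ltac:(lia)).
  assert (Hi := inv_INR_decreasing m n Hm Hmn).
  apply gap_ratio_decreasing_low; lra.
Qed.

(* Test point: [t] with [exp (alpha t) = n 4^(-alpha)], for which the power mean is at
   most [1/4] while the geometric mean tends to [1]. *)
Lemma nu1_small (alpha e : R) : alpha < 0 -> 0 < e ->
  exists N : nat, forall n : nat, (2 < n)%nat -> (N <= n)%nat -> nu1 n alpha < e.
Proof.
  intros Ha He. set (K := exp (- alpha * ln 4)).
  assert (L4 : 0 < ln 4) by (rewrite <- ln_1; apply ln_increasing; lra).
  assert (HK : 1 < K) by (unfold K; rewrite <- exp_0; apply exp_increasing; nra).
  (* [sqrt y > M] gives [2 K / (- alpha * sqrt y) < e / 3], which bounds [geom_gap] through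
     [ln y <= 2 * sqrt y]. As [y > n], it suffices that [n > M ^ 2]. *)
  set (M := 6 * K / (- alpha * e)).
  assert (HM : 0 < M) by (unfold M; apply Rdiv_lt_0_compat; nra).
  destruct (INR_unbounded (M ^ 2)) as [N HN].
  exists N. intros n Hn HNn. assert (N3 := INR_gt_2 n Hn).
  assert (Hw := inv_INR_bounds n Hn). apply le_INR in HNn.
  set (y := K * INR n). assert (Hy : 1 < y) by (unfold y; nra).
  assert (Ly : 0 < ln y) by (rewrite <- ln_1; apply ln_increasing; lra).
  set (t := ln y / alpha).
  assert (Hia : / alpha < 0) by now apply Rinv_lt_0_compat.
  assert (Ht : t < 0) by (unfold t, Rdiv; nra).
  assert (EX : exp (alpha * t) = y).
  { unfold t. replace (alpha * (ln y / alpha)) with (ln y) by (field; lra).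
    apply exp_ln. lra. }
  destruct (nu1_attained n alpha Hn Ha) as [_ [_ [_ Hmin]]].
  apply Rle_lt_trans with (1 := Hmin t Ht). clear Hmin.
  set (w := 1 / INR n) in *.
  assert (Hw3 : w <= 1 / 3).
  { unfold w. apply (proj2 (Rle_div_l _ _ (INR n) ltac:(lra))). lra. }
  assert (Lt : exp t < 1) by (rewrite <- exp_0; now apply exp_increasing).
  assert (Pt := exp_pos t).
  assert (HA : geom_gap w t <= - (w * t)).
  { unfold geom_gap, arith_mean. generalize (exp_ineq1_le (w * t)). nra. }
  (* The arithmetic mean is at least [2 / 3], the power mean at most [1 / 4]. *)
  assert (HB : 1 / 3 <= pow_gap alpha w t).
  { assert (HL : K <= pow_base alpha w t).
    { unfold pow_base. rewrite EX. unfold y, w. replace (1 / INR n * (K * INR n)) with K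
        by (field; lra). unfold w in Hw3. lra. }
    assert (Hq : exp (ln (pow_base alpha w t) / alpha) <= 1 / 4).
    { replace (1 / 4) with (exp (- ln 4)) by (rewrite exp_Ropp, exp_ln; lra).
      assert (HlL : - alpha * ln 4 <= ln (pow_base alpha w t)).
      { rewrite <- (ln_exp (- alpha * ln 4)). apply ln_le; [apply exp_pos|exact HL]. }
      assert (Hle : ln (pow_base alpha w t) / alpha <= - ln 4).
      { replace (- ln 4) with ((- alpha * ln 4) * / alpha) by (field; lra).
        unfold Rdiv. nra. }
      destruct Hle as [Hlt|E]; [left; now apply exp_increasing|rewrite E; lra]. }
    unfold pow_gap, arith_mean. nra. }
  assert (Sy : 0 < sqrt y) by (apply sqrt_lt_R0; lra).
  assert (Ey : sqrt y * sqrt y = y) by (apply sqrt_sqrt; lra).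
  assert (Hln : ln y <= 2 * sqrt y).
  { rewrite <- Ey at 1. rewrite ln_mult by assumption.
    generalize (exp_ineq1_le (ln (sqrt y))). rewrite exp_ln by assumption. lra. }
  assert (HMy : M < sqrt y).
  { apply Rsqr_incrst_0; try lra. unfold Rsqr. rewrite Ey. unfold y. nra. }
  apply (proj2 (Rlt_div_l _ _ (pow_gap alpha w t) ltac:(lra))).
  enough (- (w * t) < e / 3) by nra.
  replace (- (w * t)) with (K * ln y / (y * - alpha))
    by (unfold t, w, y; field; repeat split; lra).
  apply (proj2 (Rlt_div_l _ _ (y * - alpha) ltac:(nra))).
  assert (HMe : M * (- alpha * e) = 6 * K) by (unfold M; field; lra).
  assert (Hae : 0 < - alpha * e) by nra.
  assert (H1 : 6 * K < sqrt y * (- alpha * e)) by nra.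
  assert (H2 : K * ln y <= K * (2 * sqrt y)) by nra.
  assert (H3 : 6 * K * sqrt y < sqrt y * (- alpha * e) * sqrt y) by nra.
  replace (e / 3 * (y * - alpha)) with (sqrt y * (- alpha * e) * sqrt y / 3)
    by (rewrite <- Ey at 3; field).
  lra.
Qed.

(** Test point [exp t = 1 / n]: the arithmetic mean is at most [2 / n], the power mean at least
    [(1 / n) ^ (1 / alpha) = n ^ b / n] with [b > 0]. The ratio is then at most [2 / (n ^ b - 2)],
    which is below [e] once [n ^ b > 2 + 2 / e]. *)
Lemma nu2_small (alpha e : R) : 1 < alpha -> 0 < e ->
  exists N : nat, forall n : nat, (2 < n)%nat -> (N <= n)%nat -> - e < nu2 n alpha.
Proof.
  intros Ha He. set (b := 1 - 1 / alpha).
  assert (Hb : 0 < b).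
  { unfold b. enough (1 / alpha < 1) by lra.
    apply (proj2 (Rlt_div_l _ _ alpha ltac:(lra))). lra. }
  assert (Hie : 0 < 2 / e) by (apply Rdiv_lt_0_compat; lra).
  destruct (INR_unbounded (exp (ln (2 + 2 / e) / b))) as [N HN].
  exists N. intros n Hn HNn. assert (N3 := INR_gt_2 n Hn).
  assert (Hw := inv_INR_bounds n Hn). apply le_INR in HNn.
  set (l := ln (INR n)).
  assert (El : exp l = INR n) by (unfold l; apply exp_ln; lra).
  assert (Hl : 0 < l) by (unfold l; rewrite <- ln_1; apply ln_increasing; lra).
  assert (Hbig : 2 + 2 / e < exp (b * l)).
  { rewrite <- (exp_ln (2 + 2 / e)) by lra. apply exp_increasing.
    rewrite Rmult_comm. apply (proj1 (Rlt_div_l _ _ b Hb)).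
    apply exp_lt_inv. rewrite El. lra. }
  destruct (nu2_attained n alpha Hn Ha) as [_ [_ [_ Hmax]]].
  apply Rlt_le_trans with (2 := Hmax (- l) ltac:(lra)). clear Hmax.
  set (w := 1 - 1 / INR n) in *.
  assert (Et : exp (- l) = 1 / INR n) by (rewrite exp_Ropp, El; field; lra).
  assert (Ha2 : arith_mean w (- l) <= 2 / INR n).
  { unfold arith_mean, w. rewrite Et. unfold Rdiv in *. nra. }
  assert (HA : geom_gap w (- l) <= 2 / INR n).
  { unfold geom_gap. generalize (exp_pos (w * - l)). lra. }
  assert (Hq : exp (b * l) / INR n <= exp (ln (pow_base alpha w (- l)) / alpha)).
  { apply Rle_trans with (pow_limit alpha w).
    - right. unfold pow_limit, w, Rdiv. rewrite <- El, <- exp_Ropp, <- exp_plus.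
      replace (1 - (1 - 1 * exp (- l))) with (exp (- l)) by ring.
      rewrite ln_exp. f_equal. unfold b. field. lra.
    - assert (H := pow_mean_far_bounds alpha w (- l) ltac:(unfold w; lra) ltac:(lra) ltac:(lra)).
      assert (0 < pow_limit alpha w) by apply exp_pos.
      assert (0 < w / alpha) by (apply Rdiv_lt_0_compat; unfold w; lra).
      generalize (exp_pos (alpha * - l)). intros.
      assert (0 < pow_limit alpha w * (w / alpha) * exp (alpha * - l))
        by (apply Rmult_lt_0_compat; [nra|assumption]). lra. }
  assert (HB : 2 / INR n < e * - pow_gap alpha w (- l)).
  { unfold pow_gap.
    assert (2 / e * / INR n < exp (b * l) / INR n - 2 / INR n).
    { assert (0 < / INR n) by (apply Rinv_0_lt_compat; lra). unfold Rdiv in *. nra. }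
    replace (2 / INR n) with (e * (2 / e * / INR n)) by (field; lra). nra. }
  assert (HBp := pow_gap_neg alpha w (- l) ltac:(unfold w; lra) ltac:(lra) Ha).
  apply Ropp_lt_contravar.
  apply (proj2 (Rlt_div_l _ _ (- pow_gap alpha w (- l)) ltac:(lra))). lra.
Qed.

Theorem theorem2 (alpha : R) :
  (alpha < 0 ->
     (forall m n : nat, (2 < m)%nat -> (m < n)%nat ->
        omega1 m alpha < omega1 n alpha)
     /\ Un_cv (fun n => omega1 n alpha) 0)
  /\
  (1 < alpha ->
     (forall m n : nat, (2 < m)%nat -> (m < n)%nat ->
        omega2 n alpha < omega2 m alpha)
     /\ Un_cv (fun n => omega2 n alpha) 0)
  /\
  (1 / 2 < alpha < 1 ->
     forall m n : nat, (2 < m)%nat -> (m < n)%nat -> INR n < 1 / (1 - alpha) ->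
        omega3 m alpha < omega3 n alpha)
  /\
  (0 < alpha < 1 / 2 ->
     forall m n : nat, (2 < m)%nat -> (m < n)%nat -> INR n < 1 / alpha ->
        omega4 n alpha < omega4 m alpha).
Proof.
  split; [|split; [|split]].
  - intros Ha. split.
    + intros m n Hm Hmn. apply div_pred_decreasing; [|now apply nu1_decreasing].
      generalize (nu1_bounds m alpha Hm Ha) (nu1_bounds n alpha ltac:(lia) Ha). nra.
    + intros e He.
      (* For [0 < nu < 1], [nu / (1 - nu) < e] amounts to [nu < e / (1 + e)]. *)
      destruct (nu1_small alpha (e / (1 + e)) Ha) as [N HN];
        [apply Rdiv_lt_0_compat; lra|].
      (* For [n <= 2] nothing is known about [omega1], so the index starts at [3]. *)
      exists (max 3 N). intros n Hn.
      assert (Hb := nu1_bounds n alpha ltac:(lia) Ha).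
      specialize (HN n ltac:(lia) ltac:(lia)).
      apply (Rlt_div_r _ _ (1 + e)) in HN; [|lra].
      unfold R_dist, omega1. rewrite Rminus_0_r.
      replace (nu1 n alpha / (nu1 n alpha - 1)) with (- (nu1 n alpha / (1 - nu1 n alpha)))
        by (field; lra).
      rewrite Rabs_Ropp, Rabs_right by (apply Rle_ge, Rdiv_le_0_compat; lra).
      apply (proj2 (Rlt_div_l _ _ (1 - nu1 n alpha) ltac:(lra))). lra.
  - intros Ha. split.
    + intros m n Hm Hmn. apply div_pred_decreasing; [|now apply nu2_increasing].
      generalize (nu2_neg m alpha Hm Ha) (nu2_neg n alpha ltac:(lia) Ha). nra.
    (* As [1 - nu2 > 1], a bound on [- nu2] bounds [omega2] directly. *)
    + intros e He. destruct (nu2_small alpha e Ha He) as [N HN].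
      exists (max 3 N). intros n Hn.
      assert (Hb := nu2_neg n alpha ltac:(lia) Ha).
      specialize (HN n ltac:(lia) ltac:(lia)).
      unfold R_dist, omega2. rewrite Rminus_0_r.
      replace (nu2 n alpha / (nu2 n alpha - 1)) with (- nu2 n alpha / (1 - nu2 n alpha))
        by (field; lra).
      rewrite Rabs_right by (apply Rle_ge, Rdiv_le_0_compat; lra).
      apply (proj2 (Rlt_div_l _ _ (1 - nu2 n alpha) ltac:(lra))). nra.
  - intros Ha m n Hm Hmn HI. assert (Hlt := lt_INR m n Hmn).
    apply div_pred_decreasing; [|now apply nu3_decreasing].
    generalize (nu3_gt_1 m alpha Hm Ha ltac:(lra)) (nu3_gt_1 n alpha ltac:(lia) Ha HI). nra.
  - intros Ha m n Hm Hmn HI. assert (Hlt := lt_INR m n Hmn).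
    apply div_pred_decreasing; [|now apply nu4_increasing].
    generalize (nu4_gt_1 m alpha Hm Ha ltac:(lra)) (nu4_gt_1 n alpha ltac:(lia) Ha HI). nra.
Qed.
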